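(* Suppose that $\{X_t\}_{t\ge0}$ is a $d$-dimensional Feller process, with generator $(A,D(A))$ such that $C_c^\infty(\mathbb{R}^d)\subset D(A)$, which also has the strong Feller property. Then, for any open set $U\subset\mathbb{R}^d$ and all bounded measurable functions $u:\mathbb{R}^d\to\mathbb{R}$, the function $x\mapsto\mathbb{E}^xu(X_{\tau_U})$ is continuous on $U$, where $\tau_U=\inf\{t\ge0:X_t\notin U\}$ is the first exit time from $U$.
   Context: A ($d$-dimensional) Feller process is a Markov process $\{X_t\}_{t\ge0}$ with state space $\mathbb{R}^d$ (taken in a càdlàg version) whose transition semigroup $T_tu(x)=\mathbb{E}^xu(X_t)$ is a Feller semigroup. That is, the semigroup is sub-Markovian ($0\le u\le1$ implies $0\le T_tu\le1$ for bounded Borel $u$), it maps $C_\infty(\mathbb{R}^d)$ (continuous functions vanishing at infinity) into itself, and $\lim_{t\to0}\|T_tf-f\|_\infty=0$ for all $f\in C_\infty(\mathbb{R}^d)$. Its generator is $Au=\lim_{t\to0}(T_tu-u)/t$ (limit in sup-norm) on the set $D(A)\subset C_\infty(\mathbb{R}^d)$ of those $u\in C_\infty(\mathbb{R}^d)$ for which the limit exists. The process has the strong Feller property if $T_tf$ is bounded and continuous for every bounded Borel measurable function $f$ on $\mathbb{R}^d$ and every $t>0$. Since $C_c^\infty(\mathbb{R}^d)\subset D(A)$, on $C_c^\infty(\mathbb{R}^d)$ one has $Au(x)=-\int_{\mathbb{R}^d}e^{ix\cdot\xi}p(x,\xi)\hat u(\xi)\,d\xi$, where $\hat u(\xi)=(2\pi)^{-d}\int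 e^{-ix\cdot\xi}u(x)\,dx$, with locally bounded symbol $$p(x,\xi)=\tfrac12\,\xi\cdot a(x)\xi-ib(x)\cdot\xi+\int_{z\ne0}\big(1-e^{iz\cdot\xi}+iz\cdot\xi\,\mathbf{1}_{\{|z|\le1\}}\big)\,\nu(x,dz),$$ where for each $x\in\mathbb{R}^d$, $a(x)$ is a nonnegative definite $d\times d$ matrix, $b(x)\in\mathbb{R}^d$, and $\nu(x,dz)$ is a nonnegative, $\sigma$-finite kernel on $\mathbb{R}^d\setminus\{0\}$ with $\int_{z\ne0}(1\wedge|z|^2)\,\nu(x,dz)<\infty$. *)

(* Defs.v *)
From HB Require Import structures.
From mathcomp Require Import all_boot all_order all_algebra.
From mathcomp Require Import all_classical all_reals all_analysis.
From mathcomp Require Import measurable_realfun.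

Set Implicit Arguments.
Unset Strict Implicit.
Unset Printing Implicit Defensive.

Import Order.TTheory GRing.Theory Num.Theory.
Import numFieldNormedType.Exports.

Local Open Scope classical_set_scope.
Local Open Scope ring_scope.

(* R^d is 'rV[R]_d.  The sup norm carried by 'rV[R]_d is equivalent to the
   Euclidean one, and only the topology of R^d is used below. *)

Definition borel (T : ptopologicalType) := g_sigma_algebraType (@open T).

(* Since the semigroup is only sub-Markovian, paths may be killed or explode:
   they take values in R^d together with a cemetery point None.  A process
   without killing is one that never takes the value None. *)
Notation rV_cemetery R d := (one_point_compactification 'rV[R]_d).

(* Functions on R^d are extended by 0 to the cemetery. *)
Definition ext0 (T : Type) (V : nmodType) (u : T -> V) (z : option T) : V :=
  if z is Some x then u x else 0.

Definition bounded_borel (R : realType) (d : nat) : set ('rV[R]_d -> R) :=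
  [set u | [bounded u x | x in setT] /\
           measurable_fun setT (u : borel 'rV[R]_d -> R)].

Definition C_infty (R : realType) (d : nat) : set ('rV[R]_d -> R) :=
  [set u | continuous u /\
    forall e : R, 0 < e -> exists2 K : set 'rV[R]_d,
      compact K & forall x, ~ K x -> `|u x| < e].

Fixpoint Ck (R : realType) (d : nat) (k : nat) (u : 'rV[R]_d -> R) : Prop :=
  if k is k'.+1 then
    continuous u /\ forall i : 'I_d,
      (forall x, derivable u x (delta_mx ord0 i)) /\
      Ck k' (fun x => 'D_(delta_mx ord0 i) u x)
  else continuous u.

Definition Cc_infty (R : realType) (d : nat) : set ('rV[R]_d -> R) :=
  [set u | (forall k, Ck k u) /\ compact (closure [set x | u x != 0])].

(* A family of operators is given by a total function on all u : R^d -> R,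
   but is only considered on the bounded Borel functions. *)
Record feller_semigroup (R : realType) (d : nat)
    (T : R -> ('rV[R]_d -> R) -> 'rV[R]_d -> R) : Prop := FellerSemigroup {
  fs_borel : forall (t : R) u, 0 <= t ->
    bounded_borel u -> bounded_borel (T t u);
  fs_linear : forall (t a : R) u v, 0 <= t ->
    bounded_borel u -> bounded_borel v ->
    T t (fun x => a * u x + v x) = (fun x => a * T t u x + T t v x);
  fs_id : forall u, bounded_borel u -> T 0 u = u;
  fs_comp : forall (s t : R) u, 0 <= s -> 0 <= t -> bounded_borel u ->
    T (s + t) u = T s (T t u);
  fs_submarkov : forall (t : R) u, 0 <= t -> bounded_borel u ->
    (forall x, 0 <= u x <= 1) -> forall x, 0 <= T t u x <= 1;
  fs_C_infty : forall (t : R) u, 0 <= t -> C_infty u -> C_infty (T t u);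
  fs_cvg : forall u, C_infty u -> {uniform, T t u @[t --> 0^'+] --> u} }.

Definition strong_feller (R : realType) (d : nat)
    (T : R -> ('rV[R]_d -> R) -> 'rV[R]_d -> R) : Prop :=
  forall (t : R) u, 0 < t -> bounded_borel u ->
    [bounded T t u x | x in setT] /\ continuous (T t u).

(* generator T u v reads: u is in D(A) and A u = v. *)
Definition generator (R : realType) (d : nat)
    (T : R -> ('rV[R]_d -> R) -> 'rV[R]_d -> R) (u v : 'rV[R]_d -> R) : Prop :=
  C_infty u /\
  {uniform, (fun x => (T t u x - u x) / t) @[t --> 0^'+] --> v}.

Definition generator_domain (R : realType) (d : nat)
    (T : R -> ('rV[R]_d -> R) -> 'rV[R]_d -> R) : set ('rV[R]_d -> R) :=
  [set u | exists v, generator T u v].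

Definition natural_filtration (R : realType) (d : nat) (Omega : Type)
    (X : R -> Omega -> rV_cemetery R d) (t : R) : set (set Omega) :=
  <<s [set A | exists s : R, exists B : set (borel (rV_cemetery R d)),
         [/\ 0 <= s, s <= t, measurable B & A = X s @^-1` B] ] >>.

(* Transition function P^x(X_t \in B) for B a Borel set of R^d. *)
Definition transition (R : realType) (d : nat) (dO : measure_display)
    (Omega : measurableType dO) (P : 'rV[R]_d -> probability Omega R)
    (X : R -> Omega -> rV_cemetery R d) (t : R) (x : 'rV[R]_d)
    (B : set 'rV[R]_d) : \bar R :=
  P x (X t @^-1` (Some @` B)).

(* Time-homogeneous Markov process under the laws P^x, with X_0 = x almost
   surely under P^x, with respect to its natural filtration; only X t with
   0 <= t matters. *)
Record markov_process (R : realType) (d : nat) (dO : measure_display)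
    (Omega : measurableType dO) (P : 'rV[R]_d -> probability Omega R)
    (X : R -> Omega -> rV_cemetery R d) : Prop := MarkovProcess {
  mp_measurable : forall t : R, 0 <= t ->
    measurable_fun setT (X t : Omega -> borel (rV_cemetery R d));
  mp_start : forall x, P x (X 0 @^-1` [set Some x]) = 1%E;
  mp_absorb : forall (s t : R) w, 0 <= s -> s <= t -> X s w = None -> X t w = None;
  mp_transition : forall (t : R) (B : set (borel 'rV[R]_d)), 0 <= t -> measurable B ->
    measurable_fun setT (fun x : borel 'rV[R]_d => transition P X t x B);
  mp_markov : forall (s t : R) x (A : set Omega) (B : set (borel 'rV[R]_d)),
    0 <= s -> 0 <= t -> natural_filtration X s A -> measurable B ->
    P x (A `&` X (s + t) @^-1` (Some @` B)) =
    (\int[P x]_(w in A) ext0 (fun y => transition P X t y B) (X s w))%E }.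

(* Right-continuous with left limits in the one-point compactification. *)
Definition cadlag (R : realType) (d : nat) (f : R -> rV_cemetery R d) : Prop :=
  (forall t : R, 0 <= t -> f s @[s --> t^'+] --> f t) /\
  (forall t : R, 0 < t -> cvg (f s @[s --> t^'-])).

Definition semigroup (R : realType) (d : nat) (dO : measure_display)
    (Omega : measurableType dO) (P : 'rV[R]_d -> probability Omega R)
    (X : R -> Omega -> rV_cemetery R d)
    (t : R) (u : 'rV[R]_d -> R) (x : 'rV[R]_d) : R :=
  \int[P x]_w ext0 u (X t w).

Definition feller_process (R : realType) (d : nat) (dO : measure_display)
    (Omega : measurableType dO) (P : 'rV[R]_d -> probability Omega R)
    (X : R -> Omega -> rV_cemetery R d) : Prop :=
  [/\ markov_process P X,
      (forall w, cadlag (X ^~ w)) &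
      feller_semigroup (semigroup P X)].

(* The cemetery lies outside every U; the infimum of the empty set is +oo. *)
Definition exit_time (R : realType) (d : nat) (Omega : Type)
    (X : R -> Omega -> rV_cemetery R d) (U : set 'rV[R]_d) (w : Omega) : \bar R :=
  ereal_inf [set t%:E | t in [set t : R | 0 <= t /\ ~ (Some @` U) (X t w)]].

(* X_oo is the cemetery, so that u(X_oo) = 0. *)
Definition at_time (R : realType) (d : nat) (Omega : Type)
    (X : R -> Omega -> rV_cemetery R d) (tau : Omega -> \bar R) (w : Omega) :
    rV_cemetery R d :=
  if tau w is t%:E then X t w else None.

(* E^x u(X_tau_U).  The exit time of a cadlag Feller process is in general only
   measurable for the P^x-completion of the sigma-algebra of Omega.  The
   integral of a bounded function that agrees P^x-a.e. with a measurable one is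
   the integral of the latter (it is defined through suprema over measurable
   simple minorants of the positive and negative parts), so this is the
   integral against the completed measure. *)
Definition exit_expectation (R : realType) (d : nat) (dO : measure_display)
    (Omega : measurableType dO) (P : 'rV[R]_d -> probability Omega R)
    (X : R -> Omega -> rV_cemetery R d) (U : set 'rV[R]_d)
    (u : 'rV[R]_d -> R) (x : 'rV[R]_d) : R :=
  \int[P x]_w ext0 u (at_time X (exit_time X U) w).

(* Main.v *)
Require Import Defs.
From mathcomp Require Import all_boot all_order all_algebra.
From mathcomp Require Import all_classical all_reals all_analysis.
From mathcomp Require Import measurable_realfun lra.

(* Let g >= 0 be a function of C_infty with {g > 0} = U. The announced time, the
   supremum over n of the hitting times of {g < 1/n}, is a measurable functional
   of the path, and by quasi-left-continuity it is almost surely the exit time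
   from U; hence h(x) = E^x u(X_tau) is the mean of a functional F of the path
   with the Markov property. As long as g(X) stays above some c > 0 on [0, t[,
   F takes the same value on the path and on the path shifted by t, so that
   |h - T_t h| <= 2 |u| P^x(inf_(s < t) g(X_s) < c). By a maximal inequality, which
   only needs |T_s g - g| -> 0, this is small near every point of U when t is
   small, and T_t h is continuous by the strong Feller property: h is locally a
   uniform limit of continuous functions. *)

Set Implicit Arguments.
Unset Strict Implicit.
Unset Printing Implicit Defensive.
Import Order.TTheory GRing.Theory Num.Theory.
Import numFieldNormedType.Exports.
Local Open Scope classical_set_scope.
Local Open Scope ring_scope.

(** * Functions vanishing at infinity *)

(** The Markov property is given only at deterministic times and for one-time marginals, and the
    exit time need not be measurable, so the process is never stopped at a random time. Random times
    are reached through finite grid searches, each assembled from restarts at deterministic times,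
    followed by bounded limits. The only form of quasi-left-continuity needed is that g(X) = 0
    almost surely at the announced time: since g vanishes off U, this already identifies that time
    with the exit time. The maximal inequality is applied to min(M, g) with M = g(x0)/2; every x
    with g(x) > M is then a maximum point of the truncated function, which makes the estimate
    uniform near x0. *)

Lemma bounded_borelP (R : realType) (d : nat) (u : 'rV[R]_d -> R) :
  bounded_borel u <->
  (exists C, forall x, `|u x| <= C) /\
  measurable_fun setT (u : borel 'rV[R]_d -> R).
Proof.
split=> -[bu mu]; split => //.
  have [C [_ hC]] := bu; exists (C + 1) => x.
  by apply: hC => //; rewrite ltrDl.
case: bu => C hC; exists C; split; first exact: num_real.
by move=> y Cy x _ /=; apply: (le_trans (hC x)); exact: ltW.
Qed.

Lemma continuous_borel_measurable (R : realType) (T : ptopologicalType)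
    (u : T -> R) :
  continuous u -> measurable_fun setT (u : borel T -> R).
Proof.
move=> /continuousP cu; apply: (measurability _ (RGenOpens.measurableE R)).
move=> _ [_ [a [b ->] <-]]; rewrite setTI; apply: sub_sigma_algebra.
exact/cu/interval_open.
Qed.

Section C_infty_lemmas.
Variables (R : realType) (d : nat).
Implicit Types (u : 'rV[R]_d -> R) (O : set 'rV[R]_d).

Lemma compact_closed_ball (M : R) : compact [set x : 'rV[R]_d | `|x| <= M].
Proof.
apply: bounded_closed_compact.
  exists M; split; first exact: num_real.
  by move=> y My x /= /le_trans; apply; exact: ltW.
rewrite [X in closed X](_ : _ =
  (fun x : 'rV[R]_d => `|x|) @^-1` [set y : R | y <= M])//.
by apply: closed_comp => [x _|]; [exact: norm_continuous|exact: closed_le].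
Qed.

Lemma C_infty_bounded u : C_infty u -> exists C, forall x, `|u x| <= C.
Proof.
move=> [cu /(_ 1 ltr01)[K cK uK]].
have /compact_bounded[M [_ hM]] : compact (u @` K).
  by apply: continuous_compact => //; exact: continuous_subspaceT.
exists (`|M| + 1) => x; have [Kx|nKx] := pselect (K x).
  apply: (hM (`|M| + 1)); last by exists x.
  by rewrite (le_lt_trans (ler_norm _)) // ltrDl.
by rewrite (le_trans (ltW (uK _ nKx))) // lerDr.
Qed.

Lemma C_infty_bounded_borel u : C_infty u -> bounded_borel u.
Proof.
move=> hu; apply/bounded_borelP; split; first exact: C_infty_bounded.
by apply: continuous_borel_measurable; case: hu.
Qed.

(** Serves two purposes: min(1, n q) increases to the indicator of {q > 0}, and min(M, g) truncates
    g at a level. *)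
Lemma C_infty_minZ (M L : R) u : 0 <= M -> 0 <= L -> (forall x, 0 <= u x) ->
  C_infty u -> C_infty (fun x => Num.min M (L * u x)).
Proof.
move=> M0 L0 u0 [cu hu]; split.
  have cLu : continuous (fun x => L * u x).
    by move=> x; apply: continuousM; [exact: cst_continuous|exact: cu].
  move=> x; apply: (@continuous_min R _ (cst M) (fun x => L * u x) x).
    exact: cst_continuous.
  exact: cLu.
(* Dividing by L + 1 instead of L covers L = 0. *)
move=> e e0; have L1 : 0 < L + 1 by rewrite ltr_wpDl.
have [|K cK uK] := hu (e / (L + 1)); first by rewrite divr_gt0.
exists K => // x /uK; rewrite ger0_norm// ltr_pdivlMr// => ux.
rewrite ger0_norm ?le_min ?M0 ?mulr_ge0// gt_min; apply/orP; right.
apply: le_lt_trans ux; rewrite mulrC ler_wpM2l// lerDl//.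
Qed.

(** The function is the distance to the complement of O, cut off at 1 and divided by 1 + |x| to
    force decay at infinity. *)
Lemma open_gt0_C_infty O : open O ->
  exists2 g : 'rV[R]_d -> R, C_infty g &
    forall x, 0 <= g x <= 1 /\ (0 < g x <-> O x).
Proof.
move=> oO.
suff [q cq hq] : exists2 q : 'rV[R]_d -> R, continuous q &
    forall x, 0 <= q x <= 1 /\ (0 < q x <-> O x).
  have p1 (x : 'rV[R]_d) : 0 < 1 + `|x| by rewrite ltr_pwDl.
  have le_gq (x : 'rV[R]_d) : 0 <= q x / (1 + `|x|) <= q x.
    have [/andP[q0 q1] _] := hq x.
    rewrite divr_ge0 ?(ltW (p1 x))//= ler_pdivrMr// ler_peMr//.
    by rewrite lerDl.
  exists (fun x => q x / (1 + `|x|)).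
    split.
      have cn : continuous (fun x : 'rV[R]_d => 1 + `|x| : R).
        move=> x; apply: (@cvgD _ _ _ (nbhs x)); first exact: cvg_cst.
        exact: norm_continuous.
      have cV : continuous (fun x : 'rV[R]_d => (1 + `|x|)^-1 : R).
        by move=> x; apply: continuousV (cn x); rewrite gt_eqF.
      by move=> x; exact: continuousM (cq x) (cV x).
    move=> e e0; exists [set x : 'rV[R]_d | `|x| <= e^-1].
      exact: compact_closed_ball.
    move=> x /= /negP; rewrite -ltNge => ex.
    have [/andP[q0 q1] _] := hq x.
    have /andP[gq0 _] := le_gq x.
    rewrite ger0_norm// ltr_pdivrMr// (le_lt_trans q1)// mulrDr mulr1.
    by rewrite ltr_pwDl// -ler_pdivrMl// mulr1 ltW.
  move=> x; have [/andP[q0 q1] qO] := hq x.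
  have /andP[gq0 gq1] := le_gq x; split; first by rewrite gq0 (le_trans gq1).
  rewrite -qO; split; first by move=> /lt_le_trans; apply.
  by move=> qx; rewrite divr_gt0.
(* When O is the whole space there is no distance to take, and the constant 1 replaces it. *)
have [CO0|/set0P[y0 Oy0]] := eqVneq (~` O) set0.
  exists (cst 1); first by move=> x; exact: cst_continuous.
  move=> x; rewrite /= ler01 lexx; split => //; split => // _.
  by apply: contrapT => nOx; suff : (@set0 'rV[R]_d) x by []; rewrite -CO0.
pose S (x : 'rV[R]_d) := [set `|x - y| | y in ~` O].
have S0 x : S x !=set0 by exists `|x - y0|; exists y0.
have lbS x : lbound (S x) 0 by move=> _ [y _ <-].
have hS x : has_inf (S x) by split => //; exists 0; exact: lbS.
pose del x := inf (S x).
have del_ge0 x : 0 <= del x by exact: lb_le_inf.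
have delD x z : del x <= del z + `|x - z|.
  rewrite -lerBlDr; apply: lb_le_inf => // _ [y Oy <-]; rewrite lerBlDr.
  apply: (@le_trans _ _ `|x - y|).
    by apply: ge_inf; [exists 0; exact: lbS|exists y].
  have -> : x - y = (z - y) + (x - z) by rewrite [RHS]addrC addrA subrK.
  exact: ler_normD.
have cdel : continuous del.
  move=> x; apply/(@cvgrPdist_lt _ _ _ (nbhs x)) => e e0.
  have := nbhsx_ballx x e e0; apply: filterS => z.
  rewrite -ball_normE /= => xz.
  have xz' : `|z - x| < e by rewrite distrC.
  have := delD x z; have := delD z x; rewrite ltr_norml; lra.
exists (fun x => Num.min 1 (del x)).
  by move=> x; apply: (@continuous_min R _ (cst 1) del x);
    [exact: cst_continuous|exact: cdel].
move=> x; rewrite le_min ler01 del_ge0 ge_min lexx /=; split => //.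
rewrite lt_min ltr01 /=; split.
  move=> dx; apply: contrapT => nOx; move: dx; rewrite ltNge => /negP; apply.
  by apply: ge_inf; [exists 0; exact: lbS|exists x => //; rewrite subrr normr0].
move=> Ox; have /nbhs_ballP[e /= e0 eO] : nbhs x O by exact: open_nbhs_nbhs.
apply: (lt_le_trans e0); apply: lb_le_inf => // _ [y nOy <-].
rewrite leNgt; apply/negP => xy; apply: nOy; apply: eO.
by rewrite -ball_normE.
Qed.

(** Neighbourhoods of [None] are complements of compact sets, so vanishing at infinity is what
    continuity at [None] requires. This turns cadlag paths in the compactification into real paths
    that are right-continuous with left limits. *)
Lemma ext0_continuous u : C_infty u ->
  continuous (ext0 u : rV_cemetery R d -> R).
Proof.
move=> [cu hu] [x|] /=.
  by move=> B /cu.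
apply/(@cvgrPdist_lt _ _ _ (@nbhs _ (rV_cemetery R d) None)) => e e0.
have [K cK uK] := hu e e0; exists K.
  by split => //; apply: compact_closed => //; exact: norm_hausdorff.
by move=> z [[x nKx <-]|->] /=; rewrite sub0r normrN ?normr0 ?uK.
Qed.

End C_infty_lemmas.

(** * Means of bounded functions *)

Section bounded_expectation.
Import HBNNSimple.
Context (R : realType) (dO : measure_display) (Omega : measurableType dO).
Variable P : probability Omega R.
Implicit Types (A : set Omega) (f : Omega -> R).

Lemma bounded_integrable A f (C : R) : measurable A -> measurable_fun setT f ->
  (forall w, `|f w| <= C) -> P.-integrable A (EFin \o f).
Proof.
move=> mA mf fC; apply: measurable_bounded_integrable => //.
- by rewrite (le_lt_trans (probability_le1 P mA)) ?ltry.
- exact: measurable_funTS.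
- exists C; split; first exact: num_real.
  by move=> y Cy w _ /=; apply: (le_trans (fC w)); exact: ltW.
Qed.

Lemma bounded_convergence A (f_ : nat -> Omega -> R) f (C : R) : measurable A ->
  (forall n, measurable_fun setT (f_ n)) -> (forall n w, `|f_ n w| <= C) ->
  (forall w, f_ ^~ w @ \oo --> f w) ->
  (\int[P]_(w in A) f_ n w)%R @[n --> \oo] --> (\int[P]_(w in A) f w)%R.
Proof.
move=> mA mf fC ff.
have mlim : measurable_fun setT f by apply: measurable_fun_cvg => // w _;
  exact: ff.
have fleC w : `|f w| <= C.
  rewrite -(cvg_lim (@Rhausdorff R) (cvg_norm (ff w))).
  apply: limr_le; first by apply/cvg_ex; exists `|f w|; exact: cvg_norm.
  by apply: nearW => n; exact: fC.
have /fine_cvgP[] // : (\int[P]_(w in A) (f_ n w)%:E)%E @[n --> \oo] -->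
    (fine (\int[P]_(w in A) (f w)%:E)%E)%:E.
rewrite fineK; last by apply: integrable_fin_num => //;
  exact: (bounded_integrable mA mlim fleC).
apply: (@dominated_cvg _ _ _ _ _ mA (fun n w => (f_ n w)%:E) (fun w =>
  (f w)%:E) (cst C%:E)).
- by move=> n; apply: measurableT_comp => //; exact: measurable_funTS.
- by move=> w _; apply: cvg_EFin; [exact: nearW|exact: ff].
- by move=> w _.
- exact: finite_measure_integrable_cst.
- by move=> n w _ /=; rewrite lee_fin.
Qed.

Lemma Rintegral_prob_cst (a : R) : (\int[P]_w a)%R = a.
Proof. 
rewrite Rintegral_cst// [X in fine X](_ : _ = 1%E) ?mulr1//.
exact: probability_setT.
Qed.

Lemma bounded_Rintegral f (C : R) : measurable_fun setT f ->
  (forall w, `|f w| <= C) -> `|(\int[P]_w f w)%R| <= C.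
Proof.
move=> mf fC; have intf := bounded_integrable measurableT mf fC.
apply: (le_trans (le_normr_Rintegral _ intf)) => //.
rewrite -[leRHS](Rintegral_prob_cst C); apply: le_Rintegral => //.
- by apply: (@bounded_integrable _ _ C) => //;
    [exact: measurableT_comp|move=> w; rewrite normr_id].
- exact: finite_measure_integrable_cst.
Qed.

(* No measurability of f or g is needed: the integral of a nonnegative function
   is a supremum over the simple functions below it, and cutting such a simple
   function off on the null set N does not change its integral. *)
Lemma Rintegral_eq_off_null (N : set Omega) f g : measurable N -> P N = 0%E ->
  (forall w, ~ N w -> f w = g w) -> (\int[P]_w f w)%R = (\int[P]_w g w)%R.
Proof.
move=> mN PN.
have le_nn (a b : Omega -> \bar R) : (forall w, 0 <= b w)%E ->
    (forall w, ~ N w -> a w = b w) ->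
    (ereal_sup [set sintegral P h | h in [set h : {nnsfun Omega >-> R} |
      forall x : Omega, (h x)%:E <= a x]] <=
    ereal_sup [set sintegral P h | h in [set h : {nnsfun Omega >-> R} |
      forall x : Omega, (h x)%:E <= b x]])%E.
  move=> b0 ab; apply: ge_ereal_sup => _ [h /= ha <-].
  pose h' := proj_nnsfun h (measurableC mN).
  have -> : sintegral P h = sintegral P h'.
    rewrite -!integralT_nnsfun; apply: ae_eq_integral => //.
    - by apply/measurable_EFinP; exact: measurable_funP.
    - by apply/measurable_EFinP; exact: measurable_funP.
    exists N; split => // w /= hw; apply: contrapT => nNw; apply: hw => _.
    by rewrite /mindic indicE mem_set ?mulr1.
  apply: ereal_sup_ubound; exists h' => //= w.
  rewrite /mindic indicE; have [Nw|nNw] := pselect (N w).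
    by rewrite memNset ?mulr0//; exact.
  by rewrite mem_set// mulr1 -ab.
have le_pos (a b : Omega -> \bar R) : (forall w, ~ N w -> a w = b w) ->
    forall w, ~ N w -> (a^\+%E w = b^\+%E w) /\ (a^\-%E w = b^\-%E w).
  by move=> ab w /ab; rewrite !funeposE !funenegE => ->.
move=> fg; congr fine; rewrite /integral !patch_setT.
have fg' : forall w, ~ N w -> (EFin \o f) w = (EFin \o g) w.
  by move=> w /fg /= ->.
have H := le_pos _ _ fg'.
congr (_ - _)%E; apply/eqP; rewrite eq_le; apply/andP; split;
  apply: le_nn => // w nNw; by have [p n] := H w nNw; rewrite ?p ?n.
Qed.

End bounded_expectation.

(** A functional monotone class argument: Dynkin's theorem passes from open to Borel sets, binary
    expansions pass from indicators to functions with values in [0, 1], and an affine change of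
    scale gives the rest. *)
Lemma bounded_borel_ind (R : realType) (d : nat)
    (Q : ('rV[R]_d -> R) -> Prop) :
  (forall O, open O -> Q (\1_O)) ->
  (forall (a : R) u v, Q u -> Q v -> Q (fun x => a * u x + v x)) ->
  (forall (v : nat -> 'rV[R]_d -> R) (C : R) w, (forall n, Q (v n)) ->
    (forall n x, `|v n x| <= C) -> (forall x, v ^~ x @ \oo --> w x) -> Q w) ->
  forall u, bounded_borel u -> Q u.
Proof.
move=> Qopen Qlin Qlim.
have Qcst a : Q (fun=> a).
  have Q1 : Q (fun=> 1).
    rewrite [X in Q X](_ : _ = \1_setT); first exact/Qopen/openT.
    by apply/funext => x; rewrite indicE in_setT.
  have Q0 : Q (fun=> 0).
    rewrite [X in Q X](_ : _ = \1_set0); first exact/Qopen/open0.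
    by apply/funext => x; rewrite indicE in_set0.
  by have := Qlin a _ _ Q1 Q0; under eq_fun do rewrite mulr1 addr0.
have Qbor (B : set (borel 'rV[R]_d)) : measurable B -> Q (\1_B).
  move=> mB; apply: (@dynkin_induction _ (borel 'rV[R]_d)
    (@open 'rV[R]_d) (fun B => Q (\1_B))) => //.
  - by move=> ? ?; exact: openI.
  - exact/Qopen/openT.
  - move=> S _ QS.
    have := Qlin (-1) _ _ QS (Qcst 1).
    congr Q; apply/funext => x; rewrite !indicE in_setC.
    by case: (x \in S) => /=; rewrite ?(mulr1, mulr0, add0r, addNr).
  - move=> F mF tF QF.
    (* The sets are disjoint, so at most one term is nonzero at each point and 1 bounds all partial
       sums. *)
    apply: (Qlim (fun n x => \sum_(i < n) \1_(F i) x) 1).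
    + elim=> [|n IH]; first by under eq_fun do rewrite big_ord0.
      under eq_fun do rewrite big_ord_recr /= addrC.
      have := Qlin 1 _ _ (QF n) IH; congr Q; apply/funext => x.
      by rewrite mul1r.
    + move=> n x; have [[i Fi]|nF] := pselect (exists i, F i x); last first.
        rewrite big1 ?normr0// => i _; rewrite indicE memNset// => Fi.
        by apply: nF; exists (i : nat).
      have H (j : nat) : (\1_(F j) x : R) = (j == i)%:R.
        rewrite indicE; congr (nat_of_bool _)%:R.
        apply/idP/eqP => [|->]; last exact: mem_set.
        rewrite inE => Fj; apply: (tF) => //; by exists x.
      under eq_bigr do rewrite H.
      rewrite -natr_sum ger0_norm// lern1.
      have [ni|ni] := ltnP i n; last first.
        rewrite big1// => j _; case: eqP => // ji.
        by have := ltn_ord j; rewrite ji ltnNge ni.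
      by rewrite (bigD1 (Ordinal ni))//= eqxx big1// => j;
        rewrite -val_eqE /= => /negbTE ->.
    + move=> x; have [[i Fi]|nF] := pselect (exists i, F i x); last first.
        rewrite (_ : (fun n => _) = (fun=> \1_(\bigcup_k F k) x));
          first exact: cvg_cst.
        apply/funext => n; rewrite big1; last first.
          by move=> j _; rewrite indicE memNset// => Fj; apply: nF;
            exists (j : nat).
        by rewrite indicE memNset// => -[j _ Fj]; apply: nF; exists j.
      apply/cvgrPdist_lt => e e0; near=> n.
      rewrite indicE mem_set; last by exists i.
      have ni : (i < n)%N by near: n; exact: nbhs_infty_gt.
      rewrite (bigD1 (Ordinal ni))//= indicE mem_set//.
      rewrite big1 ?addr0 ?subrr ?normr0// => j; rewrite -val_eqE /= => ji.
      rewrite indicE memNset// => Fj; move/eqP: ji; apply.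
      by apply: (tF) => //; exists x.
(* One binary digit per step: remove the indicator of {w >= 1/2} from 2 w, approximate the
   remainder, and halve the error. *)
have Qapp n : forall w, measurable_fun setT (w : borel 'rV[R]_d -> R) ->
    (forall x, 0 <= w x <= 1) ->
    exists2 v, Q v & forall x, 0 <= v x <= 1 /\ `|w x - v x| <= 2^-1 ^+ n.
  elim: n => [|n IH] w mw w01.
    exists (fun=> 0) => // x; rewrite lexx ler01 expr0 subr0; split => //.
    by have /andP[w0 w1] := w01 x; rewrite ger0_norm.
  pose B : set (borel 'rV[R]_d) := [set x | 2^-1 <= w x].
  have mB : measurable B.
    rewrite [B](_ : _ = setT `&` w @^-1` `[2^-1, +oo[).
      by apply: mw => //; exact: measurable_itv.
    by apply/seteqP; split => x; rewrite /B /= in_itv /= andbT => // -[].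
  have [||v Qv hv] := IH (fun x => 2 * w x - \1_B x).
  - apply: measurable_funB; last exact: measurable_indic.
    exact: measurable_funM.
  - move=> x; have /andP[w0 w1] := w01 x; rewrite indicE.
    have [Bx|Bx] := pselect (B x).
      by rewrite mem_set//; move: Bx; rewrite /B /=; lra.
    by rewrite memNset//; move: Bx; rewrite /B /= => /negP; rewrite -ltNge; lra.
  exists (fun x => 2^-1 * v x + (2^-1 * \1_B x + 0)).
    by apply: (Qlin _ v (fun x => 2^-1 * \1_B x + 0)) => //; apply: Qlin => //;
      exact: Qbor.
  move=> x; have [/andP[v0 v1] hvx] := hv x.
  have b01 : 0 <= (\1_B x : R) <= 1 by rewrite indicE; case: (_ \in _);
    rewrite ?lexx ?ler01.
  split; first by move: b01 => /andP[]; lra.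
  rewrite exprS; move: hvx; rewrite !ler_norml => /andP[]; move: (_ ^+ n) => q;
    lra.
have Q01 w : measurable_fun setT (w : borel 'rV[R]_d -> R) ->
    (forall x, 0 <= w x <= 1) -> Q w.
  move=> mw w01.
  have /choice[v hv] : forall n, exists v, Q v /\
      forall x, 0 <= v x <= 1 /\ `|w x - v x| <= 2^-1 ^+ n.
    by move=> n; have [v ? ?] := Qapp n w mw w01; exists v.
  apply: (Qlim v 1) => [n|n x|x]; first by case: (hv n).
    by have [_ /(_ x)[/andP[v0 v1] _]] := hv n; rewrite ger0_norm.
  apply/cvgrPdist_le => e e0.
  have : (2^-1 : R) ^+ n @[n --> \oo] --> (0 : R).
    by apply: cvg_expr; rewrite ger0_norm; lra.
  move=> /cvgrPdist_le/(_ e e0); apply: filterS => n.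
  rewrite sub0r normrN ger0_norm ?exprn_ge0 ?invr_ge0//.
  by apply: le_trans; have [_ /(_ x)[_]] := hv n.
move=> u /bounded_borelP[[C uC] mu].
pose K := `|C| + 1; have K0 : 0 < K by rewrite /K ltr_wpDl.
have uK x : - K <= u x <= K.
  rewrite -ler_norml (le_trans (uC x))// /K (le_trans (ler_norm _))//.
  by rewrite lerDl.
have := Qlin (2 * K) _ _ (Q01 (fun x => (2 * K)^-1 * (u x + K)) _ _) (Qcst (-
  K)).
rewrite (_ : (fun x => _) = u); last first.
  by apply/funext => x; rewrite mulrA divff ?mul1r ?addrK// mulf_neq0 ?gt_eqF.
apply.
  by apply: measurable_funM => //; exact: measurable_funD.
move=> x; have /andP[uK1 uK2] := uK x.
rewrite mulrC divr_ge0 ?ler_pdivrMr; lra.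
Unshelve. all: by end_near. Qed.

(** * Measurability in the one-point compactification *)

Section cemetery.
Variables (R : realType) (d : nat).
Local Notation E := (borel (rV_cemetery R d)).

Lemma measurable_Some (B : set (borel 'rV[R]_d)) :
  measurable B -> measurable (Some @` B : set E).
Proof.
move=> mB; apply: (@dynkin_induction _ (borel 'rV[R]_d) (@open 'rV[R]_d)
  (fun B => measurable (Some @` B : set E))) => //.
- by move=> ? ?; exact: openI.
- by apply: sub_sigma_algebra; apply: one_point_compactification_open_some;
    exact: openT.
- by move=> O oO; apply: sub_sigma_algebra;
    exact: one_point_compactification_open_some.
- move=> S _ mS.
  (* The image of a complement misses the cemetery, hence a difference of images and not a
     complement. *)
  rewrite (_ : Some @` _ = (Some @` setT : set E) `\` (Some @` S : set E)).
    apply: measurableD => //; apply: sub_sigma_algebra.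
    by apply: one_point_compactification_open_some; exact: openT.
  apply/seteqP; split => [_ [x nSx <-]|_ [[x _ <-] nSx]].
    by split; [exists x|move=> [y Sy [yx]]; apply: nSx; rewrite -yx].
  by exists x => // Sx; apply: nSx; exists x.
- move=> F _ _ mF; rewrite image_bigcup; exact: bigcup_measurable.
Qed.

Lemma measurable_fun_Some : measurable_fun setT (Some : borel 'rV[R]_d -> E).
Proof.
apply: (@measurability _ _ (borel 'rV[R]_d) E _ _ (@open (rV_cemetery R d))) =>
  //.
move=> _ [ O oO <-]; rewrite setTI; apply: sub_sigma_algebra.
move/continuousP: (@one_point_compactification_some_continuous 'rV[R]_d).
exact.
Qed.

Lemma measurable_ext0 (u : 'rV[R]_d -> R) :
  measurable_fun setT (u : borel 'rV[R]_d -> R) ->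
  measurable_fun setT (ext0 u : E -> R).
Proof.
move=> mu _ B mB; rewrite setTI.
have mS : measurable (Some @` (setT : set (borel 'rV[R]_d)) : set E) by exact:
  measurable_Some.
have muB : measurable (Some @` (u @^-1` B) : set E).
  by apply: measurable_Some; rewrite -[X in measurable X]setTI; exact: mu.
(* The cemetery belongs to the preimage of B exactly when B contains 0. *)
have [B0|B0] := pselect (B 0).
  rewrite [X in measurable X](_ : _ = (Some @` (u @^-1` B)) `|` ~` (Some @`
    setT)).
    by apply: measurableU => //; exact: measurableC.
  apply/seteqP; split => [[x|] //=|z [[x Bx <-]//|]].
  - by left; exists x.
  - by right => -[].
  - by case: z => // x /= []; exists x.
rewrite [X in measurable X](_ : _ = Some @` (u @^-1` B))//.
by apply/seteqP; split => [[x|] //= Bx|_ [x Bx <-]//]; exists x.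
Qed.

End cemetery.

(** * Hitting times of real functions *)

Section hitting_times.
Variable R : realType.
Implicit Types (G F : R -> R) (c t r : R).

Definition hit_time c G : \bar R :=
  ereal_inf [set r%:E | r in [set r | 0 <= r /\ G r < c]].

(* For a cadlag path G = g o X, this is the first time at which G or its left
   limit vanishes; unlike the hitting time of {g = 0} it is measurable. *)
Definition announced_time G : \bar R :=
  ereal_sup (range (fun n : nat => hit_time n.+1%:R^-1 G)).

Definition right_continuous F := forall t, 0 <= t -> forall e, 0 < e ->
  exists2 h, 0 < h & forall s, t <= s -> s < t + h -> `|F s - F t| < e.

Definition left_limits F := forall t, 0 < t -> exists l, forall e, 0 < e ->
  exists2 h, 0 < h & forall s, t - h < s -> s < t -> `|F s - l| < e.

Lemma hit_time_ge0 c G : (0 <= hit_time c G)%E.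
Proof. by apply: le_ereal_inf_tmp => _ [r [r0 _] <-]; rewrite lee_fin. Qed.

Lemma hit_time_lt c G (x : \bar R) :
  (hit_time c G < x)%E <-> exists r, [/\ 0 <= r, (r%:E < x)%E & G r < c].
Proof.
split=> [/ereal_inf_lt[_ [r [r0 Gr] <-] rx]|[r [r0 rx Gr]]]; first by exists r.
by apply: le_lt_trans rx; apply: ereal_inf_lbound; exists r.
Qed.

Lemma hit_time_le c G r : 0 <= r -> G r < c -> (hit_time c G <= r%:E)%E.
Proof. by move=> r0 Gr; apply: ereal_inf_lbound; exists r. Qed.

Lemma le_hit_time c c' G : c <= c' -> (hit_time c' G <= hit_time c G)%E.
Proof.
move=> cc'; apply: ereal_inf_le_tmp => _ [r [r0 Gr] <-]; exists r => //.
by split => //; exact: lt_le_trans cc'.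
Qed.

Lemma hit_time_announced n G : (hit_time n.+1%:R^-1 G <= announced_time G)%E.
Proof. by apply: ereal_sup_ubound; exists n. Qed.

Lemma announced_time_ge0 G : (0 <= announced_time G)%E.
Proof. by apply: le_trans (hit_time_announced 0 G); exact: hit_time_ge0. Qed.

Lemma hit_time_fin c G (x : R) : (hit_time c G < x%:E)%E ->
  hit_time c G = (fine (hit_time c G))%:E.
Proof.
move=> h; rewrite fineK// ge0_fin_numE ?hit_time_ge0//.
by apply: (lt_trans h); exact: ltry.
Qed.

Section first_hit.
Variables (S : Type) (g f e : S -> R).

(* f, h after the first of j grid points of mesh k where g < c; if there is none,
   e at the j-th grid point. *)
Fixpoint first_hit c (k h : R) (j : nat) (p : R -> S) : R :=
  if j is j'.+1 then
    if g (p 0) < c then f (p h) else first_hit c k h j' (fun r => p (k + r))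
  else e (p 0).

Lemma first_hitP c k h j p :
  (first_hit c k h j p = e (p (j%:R * k)) /\
    forall i, (i < j)%N -> c <= g (p (i%:R * k))) \/
  exists i, [/\ (i < j)%N, g (p (i%:R * k)) < c,
    forall i', (i' < i)%N -> c <= g (p (i'%:R * k)) &
    first_hit c k h j p = f (p (i%:R * k + h))].
Proof.
elim: j p => [|j IH] p /=; first by left; rewrite mul0r.
have [gc|gc] := ltP (g (p 0)) c.
  by right; exists 0%N; rewrite mul0r add0r.
have E i : i.+1%:R * k = k + i%:R * k by rewrite -natr1 mulrDl mul1r addrC.
have [[-> hj]|[i [ij gi hi ->]]] := IH (fun r => p (k + r)).
  left; rewrite E; split => // -[_|i ij]; first by rewrite mul0r.
  by rewrite E; exact: hj.
right; exists i.+1; split; rewrite ?E ?addrA//.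
by move=> [_|i' i'i]; [rewrite mul0r|rewrite E; exact: hi].
Qed.

Lemma grid_point k r : 0 < k -> 0 <= r -> exists i : nat, r < i%:R * k <= r + k.
Proof.
move=> k0 r0; exists (Num.truncn (r / k)).+1.
have /truncn_itv /andP[h1 h2] : 0 <= r / k by rewrite divr_ge0 // ltW.
rewrite -ltr_pdivrMr// h2/= -natr1 mulrDl mul1r lerD2r.
by rewrite -ler_pdivlMr.
Qed.

(** Because the inequality G r < c is strict, right-continuity keeps G below c on an interval after
    r, and a sufficiently fine grid has a point in it. *)
Lemma grid_hit c G r (s : R) : right_continuous G -> 0 <=
  r -> r < s -> G r < c ->
  exists2 h, 0 < h & forall k, 0 < k < h -> exists i : nat,
    [/\ r < i%:R * k, i%:R * k < s & G (i%:R * k) < c].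
Proof.
move=> rG r0 rs Gr.
have [|h h0 hG] := rG r r0 (c - G r); first by rewrite subr_gt0.
exists (Num.min h (s - r)); first by rewrite lt_min h0 subr_gt0.
move=> k /andP[k0]; rewrite lt_min => /andP[kh ks].
have [i /andP[i1 i2]] := grid_point k0 r0.
have i3 : i%:R * k < r + h by apply: (le_lt_trans i2); rewrite ltrD2l.
exists i; split => //; first by rewrite (le_lt_trans i2)// -ltrBrDl.
by have := hG _ (ltW i1) i3; rewrite ltr_norml; lra.
Qed.

Lemma first_hit_bound C c k h j p : (forall z, `|f z| <= C) ->
  (forall z, `|e z| <= C) -> `|first_hit c k h j p| <= C.
Proof. by move=> fC eC; case: (first_hitP c k h j p) =>
  [[->]|[i [_ _ _ ->]]]. Qed.

(** The m(k+1) grid points of mesh 1/(k+1) cover [0, m[. If the hitting time T is at least m, none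
    of them is below level c and the default value 0 remains. Otherwise the first grid point below c
    is never before T and tends to T, so right-continuity at T + h suffices. *)
Lemma cvg_first_hit c h (m : nat) p : (forall z, e z = 0) -> 0 <= h ->
  right_continuous (g \o p) -> right_continuous (f \o p) ->
  first_hit c k.+1%:R^-1 h (m * k.+1)%N p @[k --> \oo] -->
  (if (hit_time c (g \o p) < m%:R%:E)%E
   then f (p (fine (hit_time c (g \o p)) + h)) else 0).
Proof.
move=> e_0 h0 rG rF; case: ifPn => [Tm|]; last first.
  rewrite -leNgt => mT.
  rewrite [X in X @ _](_ : _ = (fun=> 0)); first exact: cvg_cst.
  apply/funext => k; have [[-> _]|[i [ij gi _ _]]] := first_hitP c k.+1%:R^-1 h
    (m * k.+1) p; first exact: e_0.
  exfalso; have : (hit_time c (g \o p) <= (i%:R * k.+1%:R^-1 : R)%:E)%E.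
    by apply: hit_time_le => //; rewrite mulr_ge0.
  move=> /(le_trans mT); rewrite lee_fin ler_pdivlMr// -natrM ler_nat.
  by rewrite leqNgt ij.
have TE := hit_time_fin Tm; set T := fine _ in TE *.
have T0 : 0 <= T by rewrite -lee_fin -TE hit_time_ge0.
apply/cvgrPdist_lt => eps eps0.
have [|d d0 hd] := rF (T + h) _ eps eps0; first by rewrite addr_ge0.
have /hit_time_lt[r [r0]] : (hit_time c (g \o p) < (Num.min (T + d) m%:R)%:E)%E.
  by rewrite TE lte_fin lt_min ltrDl d0 -lte_fin -TE.
rewrite lte_fin lt_min => /andP[rT rm] gr.
have rs : r < Num.min (T + d) m%:R by rewrite lt_min rT.
have [a a0 ha] := grid_hit rG r0 rs gr.
have := @near_infty_natSinv_lt R (PosNum a0); apply: filterS => k /= ka.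
have [|i [ri]] := ha k.+1%:R^-1; first by rewrite ka andbT.
rewrite lt_min => /andP[iT im] gi.
have [[_ /(_ i)]|[i' [i'j gi' hi' ->]]] := first_hitP c k.+1%:R^-1 h (m * k.+1)
  p.
  move: im; rewrite ltr_pdivrMr// -natrM ltr_nat => im /(_ im).
  by rewrite leNgt gi.
(* The first grid hit i' comes no later than the hit i, so it lies between T and T + d. *)
have i'i : (i' <= i)%N by rewrite leqNgt; apply/negP => /hi'; rewrite leNgt gi.
rewrite distrC; apply: hd.
  rewrite lerD2r -lee_fin -TE; exact: hit_time_le.
rewrite addrAC ltrD2r; apply: le_lt_trans iT.
by rewrite ler_wpM2r// ler_nat.
Qed.

End first_hit.

Section stopped_limits.
Variables (F G : R -> R).
Hypotheses (rF : right_continuous F) (lF : left_limits F).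

(** The limit of [first_hit] as the mesh tends to 0. The horizon m is there because a grid search
    has finitely many steps. *)
Definition stopped_value (n m : nat) (h : R) : R :=
  if (hit_time n.+1%:R^-1 G < m%:R%:E)%E
  then F (fine (hit_time n.+1%:R^-1 G) + h) else 0.

Local Notation T n := (hit_time n.+1%:R^-1 G).

Local Lemma le_T n n' : (n <= n')%N -> (T n <= T n')%E.
Proof. by move=> nn'; apply: le_hit_time; rewrite lef_pV2 ?posrE// ler_nat. Qed.

Local Lemma T_lt_announced (t s : R) : announced_time G = t%:E -> s < t ->
  \forall n \near \oo, (s%:E < T n)%E.
Proof.
move=> Tt st; have : (s%:E < announced_time G)%E by rewrite Tt lte_fin.
move=> /ereal_sup_gt[_ [n _ <-] sT]; exists n => // n' /= nn'.
exact: (lt_le_trans sT (le_T nn')).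
Qed.

(** If some hitting time reaches m, so do all later ones and the values are eventually 0. Otherwise
    the hitting times increase to a finite announced time t. The delay h > 0 eventually carries the
    evaluation points beyond t, where right-continuity at t controls F. *)
Lemma cvg_stopped_value (m : nat) (h : R) : 0 < h ->
  exists l : R, [/\ (fun n => stopped_value n m h) @ \oo --> l,
    announced_time G = +oo%E -> l = 0 &
    forall t, announced_time G = t%:E -> t < m%:R -> forall d e, h < d ->
      (forall s, t <= s -> s < t + d -> `|F s - F t| < e) -> `|l - F t| <= e].
Proof.
move=> h0.
have [[n mT]|nmT] := pselect (exists n, (m%:R%:E <= T n)%E).
  exists 0; split => //.
    apply/cvgrPdist_lt => e e0; exists n => // n' /= nn'.
    by rewrite /stopped_value ifN ?subr0 ?normr0// -leNgt (le_trans mT (le_T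
      nn')).
  move=> t Tt tm; exfalso; move: (le_trans mT (hit_time_announced n G)).
  by rewrite Tt lee_fin leNgt tm.
have Tm n : (T n < m%:R%:E)%E.
  by rewrite ltNge; apply/negP => ?; apply: nmT; exists n.
have TE n : T n = (fine (T n))%:E by apply: hit_time_fin; exact: Tm.
have [t tE] : exists t, announced_time G = t%:E.
  exists (fine (announced_time G)); rewrite fineK// ge0_fin_numE
    ?announced_time_ge0//.
  apply: (@le_lt_trans _ _ m%:R%:E); last exact: ltry.
  by apply: ge_ereal_sup => _ [n _ <-]; exact/ltW/Tm.
have Tt n : fine (T n) <= t by rewrite -lee_fin -TE -tE hit_time_announced.
have t0 : 0 <= t by rewrite -lee_fin -tE announced_time_ge0.
have sE n : stopped_value n m h = F (fine (T n) + h).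
  by rewrite /stopped_value -/(T n) Tm.
have [l cl] : exists l : R, (fun n => stopped_value n m h) @ \oo --> l.
  (* Either t is attained and the values become F(t + h), or the points T n + h approach t + h
     strictly from the left and the left limit there is used. *)
  have [[n nt]|nt] := pselect (exists n, t <= fine (T n)).
    exists (F (t + h)); apply/cvgrPdist_lt => e e0; exists n => // n' /= nn'.
    rewrite sE (_ : fine (T n') = t) ?subrr ?normr0//.
    apply/eqP; rewrite eq_le Tt (le_trans nt)// -lee_fin -!TE; exact: le_T.
  have th0 : 0 < t + h by rewrite ltr_wpDl.
  have [l hl] := lF th0; exists l; apply/cvgrPdist_lt => e e0.
  have [d d0 hd] := hl e e0.
  have := @T_lt_announced t (t - d) tE; rewrite ltrBlDr ltrDl => /(_ d0).
  apply: filterS => n; rewrite TE lte_fin => dT; rewrite sE distrC; apply: hd.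
    by rewrite addrAC ltrD2r.
  by rewrite ltrD2r ltNge; apply/negP => ?; apply: nt; exists n.
exists l; split => //; first by rewrite tE.
move=> t'; rewrite tE => -[<-{t'}] tm d e hd Fd.
have clF : `|stopped_value n m h - F t| @[n --> \oo] --> `|l - F t|.
  by apply: cvg_norm; apply: cvgB => //; exact: cvg_cst.
rewrite -(cvg_lim (@Rhausdorff R) clF); apply: limr_le.
  by apply/cvg_ex; eexists; exact: clF.
have := @T_lt_announced t (t - h) tE; rewrite ltrBlDr ltrDl => /(_ h0).
apply: filterS => n; rewrite TE lte_fin => hT; rewrite sE ltW//; apply: Fd.
  by rewrite -lerBlDr ltW.
by rewrite (le_lt_trans (y := t + h)) ?lerD2r ?ltrD2l.
Qed.

(** One index serves both limits: the horizon m passes t while the delay 1/(m+1) tends to 0, so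
    right-continuity at t concludes. *)
Lemma cvg_announced_value :
  limn (fun n => stopped_value n m m.+1%:R^-1) @[m --> \oo] -->
  (if announced_time G is t%:E then F t else 0).
Proof.
have L m : exists l, [/\ limn (fun n => stopped_value n m m.+1%:R^-1) = l,
    announced_time G = +oo%E -> l = 0 &
    forall t, announced_time G = t%:E -> t < m%:R ->
      forall d e, m.+1%:R^-1 < d ->
      (forall s, t <= s -> s < t + d -> `|F s - F t| < e) -> `|l - F t| <= e].
  have [|l [cl l0 lt]] := @cvg_stopped_value m m.+1%:R^-1 _; first by [].
  by exists l; split => //; exact: (cvg_lim (@Rhausdorff R) cl).
have := announced_time_ge0 G; case E : (announced_time G) => [t| |] //.
  rewrite lee_fin => t0; apply/cvgrPdist_le => e e0.
  have [d d0 hd] := rF t0 e0.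
  near=> m; have [l [-> _ /(_ t E) H]] := L m; rewrite distrC;
    apply: (H _ d) => //.
    by near: m; exact: nbhs_infty_gtr.
  by near: m; exact: (@near_infty_natSinv_lt R (PosNum d0)).
move=> _; rewrite (_ : (fun m => _) = (fun=> 0)); first exact: cvg_cst.
by apply/funext => m; have [l [-> l0 _]] := L m; rewrite l0.
Unshelve. all: by end_near. Qed.

End stopped_limits.
End hitting_times.

(** * The Markov property for functionals of the path *)

Section markov_functionals.
Context (R : realType) (d : nat) (dO : measure_display)
  (Omega : measurableType dO) (P : 'rV[R]_d -> probability Omega R)
  (X : R -> Omega -> rV_cemetery R d).
Hypothesis hX : feller_process P X.
Local Notation E := (borel (rV_cemetery R d)).
Local Notation path := (R -> rV_cemetery R d).
Implicit Types (Phi Psi : path -> R) (p : path) (s t : R).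

Lemma feller_process_markov : markov_process P X.
Proof. by case: hX. Qed.

Lemma feller_process_semigroup : feller_semigroup (semigroup P X).
Proof. by case: hX. Qed.

Lemma cadlag_path w : cadlag (X ^~ w).
Proof. by case: hX. Qed.

Lemma cadlag_shift p s : 0 <= s -> cadlag p -> cadlag (fun r => p (s + r)).
Proof.
move=> s0 [rc ll].
have near_shift (Q : R -> R -> Prop) t A :
    (forall u v, Q u v -> Q (s + u) (s + v)) ->
    within (Q (s + t)) (nbhs (s + t)) A ->
    within (Q t) (nbhs t) (fun r => A (s + r)).
  move=> Qs /nbhs_ballP[e /= e0 hA]; apply/nbhs_ballP; exists e => //= r tr Qr.
  apply: hA; last exact: Qs.
  by move: tr; rewrite /ball /= opprD addrACA subrr add0r.
split => t t0.
  move=> B /(rc (s + t) (addr_ge0 s0 t0)).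
  by apply: (near_shift (fun u v => u < v)) => u v; rewrite ltrD2l.
have /cvg_ex[l hl] := ll (s + t) (ltr_wpDl s0 t0).
apply/cvg_ex; exists l => B /hl.
by apply: (near_shift (fun u v => v < u)) => u v; rewrite ltrD2l.
Qed.

Lemma natural_filtration_measurable s A : natural_filtration X s A ->
  measurable A.
Proof.
apply: smallest_sub => [|_ [r [B [r0 _ mB ->]]]];
  first exact: sigma_algebra_measurable.
by rewrite -[X in measurable X]setTI; exact: (mp_measurable
  feller_process_markov).
Qed.

Lemma natural_filtration_mono s t : s <= t ->
  natural_filtration X s `<=` natural_filtration X t.
Proof.
move=> st; apply: sub_smallest2r; first exact: smallest_sigma_algebra.
move=> _ [r [B [r0 rs mB ->]]].
by exists r, B; split => //; exact: le_trans st.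
Qed.

Lemma natural_filtrationI s A (B : set E) : 0 <= s -> measurable B ->
  natural_filtration X s A -> natural_filtration X s (A `&` X s @^-1` B).
Proof.
move=> s0 mB FA.
pose G := [set A | exists s' : R, exists B : set E,
         [/\ 0 <= s', s' <= s, measurable B & A = X s' @^-1` B]].
apply: (@measurableI _ (g_sigma_algebraType G)) => //.
by apply: sub_sigma_algebra; exists s, B.
Qed.

Lemma natural_filtrationT s : natural_filtration X s setT.
Proof.
exact: (@measurableT _ (g_sigma_algebraType [set A | exists s' : R,
  exists B : set E, [/\ 0 <= s', s' <= s, measurable B & A = X s' @^-1` B]])).
Qed.

Definition path_mean Phi (x : 'rV[R]_d) : R := \int[P x]_w Phi (X ^~ w).

(* There is no shift operator on Omega: the Markov property passes from the
   marginals to functionals of the whole path because this class is stable under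
   linear combinations, bounded limits and restarts. *)
Definition markov_functional Phi : Prop :=
  [/\ exists C, forall p, cadlag p -> `|Phi p| <= C,
    forall s, 0 <= s -> measurable_fun setT (fun w => Phi (fun r =>
      X (s + r) w)),
    bounded_borel (path_mean Phi) &
    forall s x A, 0 <= s -> natural_filtration X s A ->
      \int[P x]_(w in A) Phi (fun r => X (s + r) w) =
      \int[P x]_(w in A) ext0 (path_mean Phi) (X s w)].

Lemma markov_functional_path Phi : markov_functional Phi ->
  measurable_fun setT (fun w => Phi (X ^~ w)).
Proof.
move=> [_ /(_ 0 (lexx _)) + _ _].
by under eq_fun do under eq_fun do rewrite add0r.
Qed.

Lemma measurable_ext0_path t (u : 'rV[R]_d -> R) : 0 <= t -> bounded_borel u ->
  measurable_fun setT (fun w => ext0 u (X t w)).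
Proof.
move=> t0 /bounded_borelP[_ mu].
exact: (measurableT_comp (measurable_ext0 mu) (mp_measurable
  feller_process_markov t0)).
Qed.

Lemma ext0_bound (u : 'rV[R]_d -> R) C : (forall x, `|u x| <= C) ->
  forall z, `|ext0 u z| <= `|C|.
Proof.
by move=> uC [x|] /=; rewrite ?normr0// (le_trans (uC x))// ler_norm.
Qed.

Lemma path_mean_lin (a : R) Phi Psi :
  markov_functional Phi -> markov_functional Psi ->
  path_mean (fun p => a * Phi p + Psi p) =
    fun x => a * path_mean Phi x + path_mean Psi x.
Proof.
move=> hPhi hPsi.
have [[C1 PhiC] mPhi bPhi kPhi] := hPhi; have [[C2 PsiC] mPsi bPsi kPsi] :=
  hPsi.
apply/funext => x; rewrite /path_mean RintegralD//; last 2 first.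
- apply: (@bounded_integrable _ _ _ _ _ _ (`|a| * C1)) => //.
    by apply: measurable_funM => //; exact: markov_functional_path.
  by move=> w; rewrite normrM ler_wpM2l// PhiC//; exact: cadlag_path.
- apply: (@bounded_integrable _ _ _ _ _ _ C2) => //;
    first exact: markov_functional_path.
  by move=> w; rewrite PsiC//; exact: cadlag_path.
rewrite RintegralZl//.
apply: (@bounded_integrable _ _ _ _ _ _ C1) => //;
  first exact: markov_functional_path.
by move=> w; rewrite PhiC//; exact: cadlag_path.
Qed.

Lemma markov_functional_lin (a : R) Phi Psi :
  markov_functional Phi -> markov_functional Psi ->
  markov_functional (fun p => a * Phi p + Psi p).
Proof.
move=> hPhi hPsi.
have [[C1 PhiC] mPhi bPhi kPhi] := hPhi; have [[C2 PsiC] mPsi bPsi kPsi] :=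
  hPsi.
have pE := path_mean_lin a hPhi hPsi.
have /bounded_borelP[[D1 bD1] m1] := bPhi;
  have /bounded_borelP[[D2 bD2] m2] := bPsi.
split.
- exists (`|a| * C1 + C2) => p cp; rewrite (le_trans (ler_normD _ _))// normrM.
  by rewrite lerD ?PsiC// ler_wpM2l// PhiC.
- by move=> s s0; apply: measurable_funD; [apply: measurable_funM|]; auto.
- rewrite pE; apply/bounded_borelP; split.
    exists (`|a| * D1 + D2) => x; rewrite (le_trans (ler_normD _ _))// normrM.
    by rewrite lerD// ler_wpM2l.
  by apply: measurable_funD => //; exact: measurable_funM.
- move=> s x A s0 FA; have mA := natural_filtration_measurable FA.
  have i1 : (P x).-integrable A (EFin \o (fun w => Phi (fun r => X (s + r) w))).
    apply: (@bounded_integrable _ _ _ _ _ _ C1) => //; first exact: mPhi.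
    by move=> w; rewrite PhiC//; exact: (cadlag_shift _ (cadlag_path w)).
  have i2 : (P x).-integrable A (EFin \o (fun w => Psi (fun r => X (s + r) w))).
    apply: (@bounded_integrable _ _ _ _ _ _ C2) => //; first exact: mPsi.
    by move=> w; rewrite PsiC//; exact: (cadlag_shift _ (cadlag_path w)).
  have j1 : (P x).-integrable A (EFin \o (fun w =>
    ext0 (path_mean Phi) (X s w))).
    apply: (@bounded_integrable _ _ _ _ _ _ `|D1|) => //;
      first exact: measurable_ext0_path.
    by move=> w; exact: ext0_bound.
  have j2 : (P x).-integrable A (EFin \o (fun w =>
    ext0 (path_mean Psi) (X s w))).
    apply: (@bounded_integrable _ _ _ _ _ _ `|D2|) => //;
      first exact: measurable_ext0_path.
    by move=> w; exact: ext0_bound.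
  have iZ f : (P x).-integrable A (EFin \o f) ->
    (P x).-integrable A (EFin \o (fun w => a * f w)).
    by move=> /(integrableZl mA a); under eq_fun do rewrite -EFinM.
  rewrite RintegralD ?RintegralZl ?kPhi ?kPsi//; last exact: iZ.
  rewrite pE -RintegralZl// -RintegralD//; last exact: iZ.
  apply: eq_Rintegral => w _; case: (X s w) => [y|] //=.
  by rewrite mulr0 addr0.
Qed.

Lemma path_mean_lim (Phi_ : nat -> path -> R) Phi C :
  (forall n, markov_functional (Phi_ n)) ->
  (forall n p, cadlag p -> `|Phi_ n p| <= C) ->
  (forall p, cadlag p -> Phi_ ^~ p @ \oo --> Phi p) ->
  forall x, path_mean (Phi_ n) x @[n --> \oo] --> path_mean Phi x.
Proof.
move=> hPhi PhiC cPhi x.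
apply: (@bounded_convergence _ _ _ _ _ (fun n w => Phi_ n (X ^~ w)) _ C) => //.
- by move=> n; exact: markov_functional_path.
- by move=> n w; apply: PhiC; exact: cadlag_path.
- by move=> w; apply: cPhi; exact: cadlag_path.
Qed.

(** Bounded convergence on both sides of the Markov identity. Bound and limit are asked along cadlag
    paths only, because stopped values converge only there; sample paths and their shifts are
    cadlag. *)
Lemma markov_functional_lim (Phi_ : nat -> path -> R) Phi C :
  (forall n, markov_functional (Phi_ n)) ->
  (forall n p, cadlag p -> `|Phi_ n p| <= C) ->
  (forall p, cadlag p -> Phi_ ^~ p @ \oo --> Phi p) ->
  markov_functional Phi.
Proof.
move=> hPhi PhiC cPhi.
have pC n x : `|path_mean (Phi_ n) x| <= C.
  apply: bounded_Rintegral; first exact: markov_functional_path.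
  by move=> w; apply: PhiC; exact: cadlag_path.
have cp := path_mean_lim hPhi PhiC cPhi.
split.
- exists C => p hp; rewrite -(cvg_lim (@Rhausdorff R) (cvg_norm (cPhi p hp))).
  apply: limr_le; first by apply/cvg_ex; eexists; exact: (cvg_norm (cPhi p hp)).
  by apply: nearW => n; exact: PhiC.
- move=> s s0; apply: (measurable_fun_cvg (h := fun n w => Phi_ n (fun r =>
    X (s + r) w))).
    by move=> n; have [_ + _ _] := hPhi n; exact.
  by move=> w _; apply: cPhi; exact: (cadlag_shift _ (cadlag_path w)).
- apply/bounded_borelP; split.
    exists C => x; rewrite -(cvg_lim (@Rhausdorff R) (cvg_norm (cp x))).
    apply: limr_le; first by apply/cvg_ex; eexists; exact: (cvg_norm (cp x)).
    by apply: nearW => n; exact: pC.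
  apply: (measurable_fun_cvg (h := fun n (x : borel 'rV[R]_d) =>
    path_mean (Phi_ n) x)).
    by move=> n; have [_ _ /bounded_borelP[]] := hPhi n.
  by move=> x _; exact: cp.
- move=> s x A s0 FA; have mA := natural_filtration_measurable FA.
  have c1 : \int[P x]_(w in A) Phi_ n (fun r => X (s + r) w) @[n --> \oo] -->
      \int[P x]_(w in A) Phi (fun r => X (s + r) w).
    apply: (@bounded_convergence _ _ _ _ _ (fun n w => Phi_ n (fun r =>
      X (s + r) w)) _ C) => //.
    - by move=> n; have [_ + _ _] := hPhi n; exact.
    - by move=> n w; apply: PhiC; exact: (cadlag_shift _ (cadlag_path w)).
    - by move=> w; apply: cPhi; exact: (cadlag_shift _ (cadlag_path w)).
  have c2 : \int[P x]_(w in A) ext0 (path_mean (Phi_ n)) (X s w) @[n --> \oo]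
    -->
      \int[P x]_(w in A) ext0 (path_mean Phi) (X s w).
    apply: (@bounded_convergence _ _ _ _ _ (fun n w =>
      ext0 (path_mean (Phi_ n)) (X s w)) _ `|C|) => //.
    - by move=> n; apply: measurable_ext0_path => //; case: (hPhi n).
    - by move=> n w; exact: ext0_bound.
    - by move=> w; case: (X s w) => [y|] /=; [exact: cp|exact: cvg_cst].
  apply: (cvg_unique (@Rhausdorff R) c1); apply: cvg_trans c2.
  rewrite [X in X @ \oo](_ : _ =
    (fun n => \int[P x]_(w in A) ext0 (path_mean (Phi_ n)) (X s w)))//.
  by apply/funext => n; have [_ _ _ ->] := hPhi n.
Qed.

(** The base of the class: for indicators of open sets this is [mp_markov], and [bounded_borel_ind]
    does the rest. The mean of this functional is [semigroup P X t f] by definition. *)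
Lemma markov_functional_eval t (f : 'rV[R]_d -> R) : 0 <=
  t -> bounded_borel f ->
  markov_functional (fun p => ext0 f (p t)).
Proof.
move=> t0; move: f.
apply: (@bounded_borel_ind _ _ (fun f => markov_functional (fun p =>
  ext0 f (p t))))
  => [ O oO|a u v hu hv|v C f hv vC vf].
- have bO : bounded_borel (\1_O : 'rV[R]_d -> R).
    apply/bounded_borelP; split.
      by exists 1 => x; rewrite indicE; case: (_ \in _);
        rewrite ?normr1 ?normr0.
    by apply: measurable_indic; exact: sub_sigma_algebra.
  have eO z : ext0 (\1_O : _ -> R) z = \1_(Some @` O) z.
    rewrite indicE; case: z => [x|] /=; rewrite ?indicE.
      congr (nat_of_bool _)%:R; apply/idP/idP; rewrite !inE; first by exists x.
      by move=> [y Oy [<-]].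
    by rewrite memNset// => -[].
  have mSO : measurable (Some @` O : set E) by apply: measurable_Some;
    exact: sub_sigma_algebra.
  have mX s : 0 <= s -> measurable (X s @^-1` (Some @` O)).
    by move=> s0; rewrite -[X in measurable X]setTI;
      exact: (mp_measurable feller_process_markov).
  have iO s x A : 0 <= s -> measurable A ->
      \int[P x]_(w in A) ext0 (\1_O : _ -> R) (X s w) =
      fine (P x (A `&` X s @^-1` (Some @` O))).
    move=> s0 mA; congr fine; rewrite setIC -integral_indic//; last exact: mX.
    by apply: eq_integral => w _; rewrite eO.
  split.
  + by exists 1 => p _; rewrite eO indicE; case: (_ \in _);
      rewrite ?normr1 ?normr0.
  + by move=> s s0; apply: measurable_ext0_path => //; exact: addr_ge0.
  + exact: (fs_borel feller_process_semigroup).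
  + move=> s x A s0 FA; have mA := natural_filtration_measurable FA.
    rewrite iO ?addr_ge0//; congr fine; rewrite (mp_markov
      feller_process_markov) //; last exact: sub_sigma_algebra.
    apply: eq_integral => w _; case: (X s w) => [y|] //=.
    rewrite /path_mean iO// setTI fineK//.
    by apply: fin_num_measure; exact: mX.
- rewrite [X in markov_functional X](_ : _ = fun p =>
    a * ext0 u (p t) + ext0 v (p t)).
    exact: markov_functional_lin.
  by apply/funext => p; case: (p t) => //=; rewrite mulr0 addr0.
- apply: (@markov_functional_lim (fun n p => ext0 (v n) (p t)) _ `|C|) => //.
    by move=> n p _; exact: ext0_bound.
  by move=> p _; case: (p t) => [x|] /=; [exact: vf|exact: cvg_cst].
Qed.

Lemma Rintegral_start (v : 'rV[R]_d -> R) x :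
  \int[P x]_w ext0 v (X 0 w) = v x.
Proof.
have m0 : measurable (X 0 @^-1` [set Some x]).
  rewrite -[X in measurable X]setTI; apply: (mp_measurable
    feller_process_markov) => //.
  rewrite -image_set1; apply: measurable_Some.
  rewrite -[X in measurable X]setCK; apply: measurableC;
    apply: sub_sigma_algebra.
  apply: closed_openC; apply: compact_closed; first exact: norm_hausdorff.
  exact: compact_set1.
rewrite -[RHS](Rintegral_prob_cst (P x)).
apply: (@Rintegral_eq_off_null _ _ _ _ (~` (X 0 @^-1` [set Some x]))).
- exact: measurableC.
- by rewrite probability_setC// (mp_start feller_process_markov) subee.
- by move=> w /contrapT /= ->.
Qed.

(** Absorb the indicator into the event A, which keeps it in the past of s. The Markov property of
    Phi at s + t, then that of evaluation at time t, give the identity; the formula for the mean is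
    its case s = 0. *)
Lemma markov_functional_restart t (B : set E) Phi : 0 <= t -> measurable B ->
  markov_functional Phi ->
  markov_functional (fun p => \1_B (p 0) * Phi (fun r => p (t + r))) /\
  path_mean (fun p => \1_B (p 0) * Phi (fun r => p (t + r))) =
    (fun x => \1_B (Some x) * semigroup P X t (path_mean Phi) x).
Proof.
move=> t0 mB [[C PhiC] mPhi bPhi kPhi].
have key s x A : 0 <= s -> natural_filtration X s A ->
    \int[P x]_(w in A) (\1_B (X (s + 0) w) * Phi (fun r => X (s + (t + r)) w)) =
    \int[P x]_(w in A) ext0 (fun x => \1_B (Some x) * semigroup P X t
      (path_mean Phi) x) (X s w).
  move=> s0 FA.
  have memB w : (w \in X s @^-1` B) = (X s w \in B) by apply/idP/idP;
    rewrite !inE.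
  have FAB := natural_filtrationI s0 mB FA.
  have [_ _ _ /(_ s x _ s0 FAB) h2] := markov_functional_eval t0 bPhi.
  have h1 := kPhi (s + t) x _ (addr_ge0 s0 t0)
    (natural_filtration_mono (s := s) (t := s + t) _ FAB).
  transitivity (\int[P x]_(w in A `&` X s @^-1` B) Phi (fun r =>
    X (s + t + r) w)).
    rewrite Rintegral_mkcondr; apply: eq_Rintegral => w _; rewrite addr0 patchE.
    rewrite indicE memB; case: ifPn => _; last by rewrite mul0r.
    by rewrite mul1r; congr Phi; apply/funext => r; rewrite addrA.
  rewrite h1 ?lerDl// h2 Rintegral_mkcondr; apply: eq_Rintegral => w _;
    rewrite patchE.
  (* On killed paths both sides are 0, whether or not B contains the cemetery. *)
  rewrite memB; case: (X s w) => [y|] /=; last by case: ifP.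
  by rewrite indicE; case: ifPn => _; rewrite ?mul1r ?mul0r.
have pE : path_mean (fun p => \1_B (p 0) * Phi (fun r => p (t + r))) =
    (fun x => \1_B (Some x) * semigroup P X t (path_mean Phi) x).
  apply/funext => x.
  rewrite -[RHS](Rintegral_start (fun x => \1_B (Some x) * semigroup P X t
    (path_mean Phi) x)).
  rewrite -key//; last exact: natural_filtrationT.
  apply: eq_Rintegral => w _; rewrite add0r; congr (_ * Phi _).
  by apply/funext => r; rewrite add0r.
split => //; split.
- exists `|C| => p cp; rewrite indicE.
  have Cp := PhiC _ (cadlag_shift t0 cp).
  case: (_ \in _); rewrite ?mul1r ?mul0r ?normr0//.
  by rewrite (le_trans Cp)// ler_norm.
- move=> s s0; apply: measurable_funM.
    apply: (measurableT_comp (f := (\1_B : E -> R)));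
      first exact: measurable_indic.
    by rewrite addr0; exact: (mp_measurable feller_process_markov).
  have := mPhi (s + t) (addr_ge0 s0 t0); congr (measurable_fun _ _).
  by apply/funext => w; congr Phi; apply/funext => r; rewrite addrA.
- rewrite pE.
  have /bounded_borelP[[D hD] mT] := fs_borel feller_process_semigroup t0 bPhi.
  apply/bounded_borelP; split.
    exists D => x; rewrite normrM indicE; case: (_ \in _);
      rewrite ?normr1 ?normr0 ?mul1r ?mul0r//.
    by rewrite (le_trans _ (hD x)).
  apply: measurable_funM => //.
  apply: (measurableT_comp (f := (\1_B : E -> R)));
    first exact: measurable_indic.
  exact: measurable_fun_Some.
- by move=> s x A s0 FA; rewrite pE; exact: key.
Qed.

End markov_functionals.

(** * Means of grid functionals and the semigroup *)

Section semigroup_estimates.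
Context (R : realType) (d : nat) (dO : measure_display)
  (Omega : measurableType dO) (P : 'rV[R]_d -> probability Omega R)
  (X : R -> Omega -> rV_cemetery R d).
Hypothesis hX : feller_process P X.
Local Notation E := (borel (rV_cemetery R d)).
Local Notation path := (R -> rV_cemetery R d).
Local Notation T := (semigroup P X).
Implicit Types (Phi Psi : path -> R) (p : path) (s t : R) (u v f g : 'rV[R]_d
  -> R).

Lemma integrable_semigroup t u x : 0 <= t -> bounded_borel u ->
  (P x).-integrable setT (EFin \o (fun w => ext0 u (X t w))).
Proof.
move=> t0 bu; have /bounded_borelP[[C uC] _] := bu.
apply: (@bounded_integrable _ _ _ _ _ _ `|C|) => //;
  first exact: (measurable_ext0_path hX).
by move=> w; exact: ext0_bound.
Qed.

Lemma semigroup_le t u v x : 0 <= t -> bounded_borel u -> bounded_borel v ->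
  (forall y, u y <= v y) -> T t u x <= T t v x.
Proof.
move=> t0 bu bv uv; apply: le_Rintegral => //; try exact: integrable_semigroup.
by move=> w _; case: (X t w) => [y|] /=.
Qed.

Lemma bounded_borel_cst (a : R) : bounded_borel ((fun=> a) : 'rV[R]_d -> R).
Proof.
by apply/bounded_borelP; split; [by exists (`|a|)|exact: measurable_cst].
Qed.

(** K has to be nonnegative because killed paths contribute 0 to the mean. *)
Lemma semigroup_le_cst t u (K : R) x : 0 <= t -> 0 <= K -> bounded_borel u ->
  (forall y, u y <= K) -> T t u x <= K.
Proof.
move=> t0 K0 bu uK; rewrite -[leRHS](Rintegral_prob_cst (P x)).
apply: le_Rintegral => //; first exact: integrable_semigroup.
- exact: finite_measure_integrable_cst.
- by move=> w _; case: (X t w) => [y|] /=.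
Qed.

Lemma path_mean_ge0 Phi x : (forall p, 0 <= Phi p) -> 0 <= path_mean P X Phi x.
Proof. by move=> Phi0; apply: Rintegral_ge0. Qed.

Lemma measurable_lt_ext0 g (c : R) : bounded_borel g ->
  measurable ([set z | ext0 g z < c] : set E).
Proof.
move=> /bounded_borelP[_ mg].
rewrite [X in measurable X](_ : _ = setT `&` (ext0 g : E -> R) @^-1` `]-oo, c[).
  by apply: (measurable_ext0 mg) => //; exact: measurable_itv.
by apply/seteqP; split => z /=; rewrite in_itv /= => // -[].
Qed.

(** Each layer of the recursion is a sum of two restarts, selected by g(p 0) < c: after time h to
    evaluate f, after time k to continue the search. Means therefore satisfy a one-step recursion,
    on which the estimates below are inductions. *)
Lemma markov_functional_first_hit g f v (c k h : R) j : bounded_borel g ->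
  bounded_borel f -> bounded_borel v -> 0 <= k -> 0 <= h ->
  markov_functional P X (first_hit (ext0 g) (ext0 f) (ext0 v) c k h j) /\
  forall x, path_mean P X (first_hit (ext0 g) (ext0 f) (ext0 v) c k h j.+1) x =
    if g x < c then T h f x
    else T k (path_mean P X (first_hit (ext0 g) (ext0 f) (ext0 v) c k h j)) x.
Proof.
move=> bg bf bv k0 h0.
set fh := first_hit (ext0 g) (ext0 f) (ext0 v) c k h.
set B : set E := [set z | ext0 g z < c].
have mB : measurable B by exact: measurable_lt_ext0.
have BE (z : E) : \1_B z = ((ext0 g z < c)%R : bool)%:R :> R.
  by rewrite indicE; congr (nat_of_bool _)%:R; apply/idP/idP; rewrite !inE.
have CBE (z : E) : \1_(~` B) z = (~~ (ext0 g z < c)%R)%:R :> R.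
  rewrite indicE in_setC; congr (nat_of_bool (~~ _))%:R.
  by apply/idP/idP; rewrite !inE.
have [MF1 pm1] := markov_functional_restart hX h0 mB (markov_functional_eval hX
  (lexx 0) bf).
have fhE j' : fh j'.+1 = fun p => 1 * (\1_B (p 0) * ext0 f (p (h + 0))) +
    \1_(~` B) (p 0) * fh j' (fun r => p (k + r)).
  apply/funext => p; rewrite BE CBE addr0 /fh /=.
  by case: (ext0 g (p 0) < c); rewrite ?mul1r ?mul0r ?addr0 ?add0r.
have MF j' : markov_functional P X (fh j').
  elim: j' => [|j' IH]; first exact: markov_functional_eval.
  rewrite fhE; have [MF2 _] := markov_functional_restart hX k0 (measurableC mB)
    IH.
  exact: (markov_functional_lin hX 1 MF1 MF2).
split => [|x]; first exact: MF.
have [MF2 pm2] := markov_functional_restart hX k0 (measurableC mB) (MF j).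
rewrite -/fh fhE (path_mean_lin hX 1 MF1 MF2) pm1 pm2 mul1r BE CBE /=.
have -> : path_mean P X (fun p => ext0 f (p 0)) = f.
  by apply/funext => y; exact: Rintegral_start.
by case: (g x < c); rewrite ?mul1r ?mul0r ?addr0 ?add0r.
Qed.

(** Induction on j: a hit at the start gives T_h g(x) <= g(x) + eps < c + eps; otherwise T_k is
    applied to a function bounded by c + eps. *)
Lemma path_mean_first_hit_le g (c k h eps : R) j x : C_infty g ->
  0 <= c -> 0 <= eps -> 0 <= k -> 0 <= h ->
  (forall y, `|T h g y - g y| <= eps) ->
  path_mean P X (first_hit (ext0 g) (ext0 g) (ext0 (fun=> 0)) c k h j) x <=
    c + eps.
Proof.
move=> /C_infty_bounded_borel bg c0 eps0 k0 h0 hT;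
  have ceps0 : 0 <= c + eps by exact: addr_ge0.
have H j' := markov_functional_first_hit c j' bg bg (bounded_borel_cst 0) k0 h0.
elim: j x => [|j IH] x.
  by rewrite (_ : path_mean _ _ _ _ = 0)//;
    exact: (Rintegral_start hX (fun=> 0)).
have [[_ _ bm _] ->] := H j; case: ifPn => gc.
  by have := hT x; rewrite ler_norml; lra.
exact: semigroup_le_cst.
Qed.

(* Maximal inequality: the functional is the indicator of g(X_(ik)) >= c for all
   i < j, and once g(X_(ik)) < c the mean of g(X_(jk)) is at most c + eps. *)
Lemma semigroup_le_first_hit g (M c k t eps : R) j x : C_infty g ->
  (forall y, g y <= M) -> 0 <= c -> 0 <= eps -> c + eps <= M -> 0 <= k ->
  j%:R * k <= t ->
  (forall s y, 0 <= s <= t -> `|T s g y - g y| <= eps) ->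
  T (j%:R * k) g x <= (M - (c + eps)) *
    path_mean P X (first_hit (ext0 g) (ext0 (fun=> 0)) (ext0 (fun=> 1)) c k 0
      j) x +
    (c + eps).
Proof.
move=> /C_infty_bounded_borel bg gM c0 eps0 cM k0 + hT.
have H j' := markov_functional_first_hit c j' bg (bounded_borel_cst 0)
  (bounded_borel_cst 1) k0 (lexx 0).
elim: j x => [|j IH] x jkt.
  rewrite (_ : path_mean _ _ _ _ = 1); last exact: (Rintegral_start hX (fun=>
    1)).
  rewrite mulr1 subrK.
  by rewrite mul0r (fs_id (feller_process_semigroup hX)).
have [[_ _ bm _] ->] := H j; case: ifPn => gc.
  have jk : 0 <= j.+1%:R * k <= t by rewrite jkt mulr_ge0.
  have := hT _ x jk.
  rewrite (fs_id (feller_process_semigroup hX)); last exact: bounded_borel_cst.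
  by rewrite ler_norml mulr0 add0r; lra.
have E1 : j.+1%:R * k = k + j%:R * k by rewrite -natr1 mulrDl mul1r addrC.
have jk0 : 0 <= j%:R * k by rewrite mulr_ge0.
rewrite E1 (fs_comp (feller_process_semigroup hX))//.
set pm := path_mean _ _ _ in bm IH *.
have b1 : bounded_borel (fun y => (c + eps) * 1 + 0 : R) := bounded_borel_cst _.
have bpm : bounded_borel (fun y => (M - (c + eps)) * pm y + (c + eps)).
  have /bounded_borelP[[D hD] mpm] := bm; apply/bounded_borelP; split.
    exists ((M - (c + eps)) * D + (c + eps)) => y.
    have M0 : 0 <= M - (c + eps) by rewrite subr_ge0.
    have ce0 : 0 <= c + eps by exact: addr_ge0.
    rewrite (le_trans (ler_normD _ _))// normrM (ger0_norm M0) (ger0_norm ce0).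
    by rewrite lerD2r ler_wpM2l.
  by apply: measurable_funD => //; exact: measurable_funM.
apply: (@le_trans _ _ (T k (fun y => (M - (c + eps)) * pm y + (c + eps)) x)).
  apply: semigroup_le => //; first exact: (fs_borel (feller_process_semigroup
    hX)).
  by move=> y; apply: IH; apply: le_trans jkt; rewrite E1 lerDr.
(* By linearity only T_k(c + eps) <= c + eps is left, with possible strict loss through killing. *)
rewrite (fs_linear (feller_process_semigroup hX)) ?lerD2l//;
  last exact: bounded_borel_cst.
by apply: semigroup_le_cst => //; [exact: addr_ge0|exact: bounded_borel_cst].
Qed.

Lemma semigroup_cvg0 g (e : R) : C_infty g -> 0 < e ->
  exists2 t0, 0 < t0 & forall t x, 0 <= t < t0 -> `|T t g x - g x| <= e.
Proof.
move=> cg e0.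
have H : nbhs (g : {uniform 'rV[R]_d -> R}) [set h | forall y,
  `|g y - h y| < e].
  apply/uniform_nbhs; exists [set xy | ball xy.1 e xy.2]; split.
    exact: (entourage_ball _ (PosNum e0)).
  by move=> h hh y; exact: hh.
have /nbhs_ballP[t0 /= t00 ht] := fs_cvg (feller_process_semigroup hX) cg H.
exists t0 => // t x /andP[]; rewrite le_eqVlt => /predU1P[<- _|tgt0 tt0].
  by rewrite (fs_id (feller_process_semigroup hX)) ?subrr ?normr0 ?ltW//;
    exact: C_infty_bounded_borel.
rewrite distrC ltW//; apply: (ht t) => //.
by rewrite /ball /= sub0r normrN gtr0_norm.
Qed.

End semigroup_estimates.

(** * The place of the path at its announced time *)

Section announced_value.
Context (R : realType) (d : nat) (dO : measure_display)
  (Omega : measurableType dO) (P : 'rV[R]_d -> probability Omega R)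
  (X : R -> Omega -> rV_cemetery R d).
Hypothesis hX : feller_process P X.
Local Notation path := (R -> rV_cemetery R d).
Local Notation T := (semigroup P X).
Implicit Types (p : path) (s t : R) (u v f : 'rV[R]_d -> R).

Lemma cadlag_right_continuous f p : C_infty f -> cadlag p ->
  right_continuous (ext0 f \o p).
Proof.
move=> cf [rc _] t t0 e e0.
have : (ext0 f \o p) s @[s --> t^'+] --> (ext0 f \o p) t.
  apply: (cvg_comp _ _ (rc t t0)); exact: (ext0_continuous cf).
move=> /(@cvgrPdist_lt _ _ _ _ _)/(_ e e0) /nbhs_ballP[h /= h0 hh].
exists h => // s ts sh; move: ts; rewrite le_eqVlt => /predU1P[->|ts].
  by rewrite subrr normr0.
rewrite distrC; apply: hh => //.
by rewrite /ball /= ltr_norml; lra.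
Qed.

Lemma cadlag_left_limits f p : C_infty f -> cadlag p ->
  left_limits (ext0 f \o p).
Proof.
move=> cf [_ ll] t t0; have /cvg_ex[z hz] := ll t t0.
exists (ext0 f z) => e e0.
have : (ext0 f \o p) s @[s --> t^'-] --> ext0 f z.
  apply: (cvg_comp _ _ hz); exact: (ext0_continuous cf).
move=> /(@cvgrPdist_lt _ _ _ _ _)/(_ e e0) /nbhs_ballP[h /= h0 hh].
exists h => // s ts sh.
rewrite distrC; apply: hh => //.
by rewrite /ball /= ltr_norml; lra.
Qed.

Variable g : 'rV[R]_d -> R.
Hypothesis cg : C_infty g.

(** A function of the path alone, so that it can be restarted; [None] at infinite time agrees with
    [at_time]. *)
Definition announced_place p : rV_cemetery R d :=
  if announced_time (ext0 g \o p) is t%:E then p t else None.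

Local Definition stage (f : 'rV[R]_d -> R) (m n k : nat) : path -> R :=
  first_hit (ext0 g) (ext0 f) (ext0 (fun=> 0)) n.+1%:R^-1 k.+1%:R^-1 m.+1%:R^-1
    (m * k.+1).

Local Notation delayed f m n p :=
  (stopped_value (ext0 f \o p) (ext0 g \o p) n m m.+1%:R^-1).

(* The value of f at the announced time is reached in the order k, n, m: grid
   hitting times decrease to the hitting time of {g < 1/(n+1)}, which increases to
   the announced time; the delay 1/(m+1), removed last, keeps the evaluation
   points to the right of the announced time. *)
Local Lemma stage_limits f (C : R) : C_infty f -> (forall x, `|f x| <= C) ->
  [/\ forall m n k, markov_functional P X (stage f m n k),
    (forall m n k p, cadlag p -> `|stage f m n k p| <= `|C|) /\
    (forall m n p, cadlag p -> stage f m n ^~ p @ \oo --> delayed f m n p),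
    (forall m n p, cadlag p -> `|delayed f m n p| <= `|C|) /\
    (forall m p, cadlag p -> (fun n => delayed f m n p) @ \oo -->
      limn (fun n => delayed f m n p)),
    (forall m p, cadlag p -> `|limn (fun n => delayed f m n p)| <= `|C|) &
    (forall p, cadlag p -> (fun m => limn (fun n => delayed f m n p)) @ \oo -->
      ext0 f (announced_place p))].
Proof.
move=> cf fC; have bf := C_infty_bounded_borel cf.
have bg := C_infty_bounded_borel cg.
have sC m n p : `|delayed f m n p| <= `|C|.
  by rewrite /stopped_value; case: ifP => _; rewrite ?normr0//;
    exact: ext0_bound.
have cvgs m p : cadlag p -> (fun n => delayed f m n p) @ \oo -->
    limn (fun n => delayed f m n p).
  move=> cp; have [|l [cl _ _]] := @cvg_stopped_value R (ext0 f \o p)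
    (ext0 g \o p) (cadlag_left_limits cf cp) m m.+1%:R^-1 _; first by [].
  by rewrite (cvg_lim (@Rhausdorff R) cl).
split => //.
- move=> m n k.
  have i0 (l : nat) : 0 <= l.+1%:R^-1 :> R by [].
  by have [] := markov_functional_first_hit hX n.+1%:R^-1 (m * k.+1) bg bf
    (bounded_borel_cst d 0) (i0 k) (i0 m).
- split.
    move=> m n k p _; apply: first_hit_bound; first exact: ext0_bound.
    by move=> [x|] /=; rewrite normr0.
  move=> m n p cp; rewrite /stage.
  apply: (@cvg_first_hit R _ (ext0 g) (ext0 f) (ext0 (fun=> 0))) => //.
  + by case.
  + exact: cadlag_right_continuous.
  + exact: cadlag_right_continuous.
- move=> m p cp; rewrite -(cvg_lim (@Rhausdorff R) (cvg_norm (cvgs m p cp))).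
  apply: limr_le; first by apply/cvg_ex; eexists;
    exact: (cvg_norm (cvgs m p cp)).
  by apply: nearW => n.
- move=> p cp.
  rewrite (_ : ext0 f _ =
    if announced_time (ext0 g \o p) is t%:E then (ext0 f \o p) t else 0).
    apply: cvg_announced_value; first exact: cadlag_right_continuous.
    exact: cadlag_left_limits.
  by rewrite /announced_place; case: announced_time.
Qed.

Lemma markov_functional_announced_C_infty f : C_infty f ->
  markov_functional P X (fun p => ext0 f (announced_place p)).
Proof.
move=> cf; have [C fC] := C_infty_bounded cf.
have [MF0 [b0 c0] [b1 c1] b2 c2] := stage_limits cf fC.
have MF1 m n : markov_functional P X (fun p => delayed f m n p).
  exact: (markov_functional_lim hX (MF0 m n) (b0 m n) (c0 m n)).
have MF2 m : markov_functional P X (fun p => limn (fun n => delayed f m n p)).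
  exact: (markov_functional_lim hX (MF1 m) (b1 m) (c1 m)).
exact: (markov_functional_lim hX MF2 b2 c2).
Qed.

(** The path limits need a continuous function of the state. Once the announced place is reached,
    only its state varies: indicators of open sets are limits of min(1, n q), and monotone classes
    apply. *)
Lemma markov_functional_announced u : bounded_borel u ->
  markov_functional P X (fun p => ext0 u (announced_place p)).
Proof.
move: u; apply: (@bounded_borel_ind _ _
  (fun u => markov_functional P X (fun p => ext0 u (announced_place p))))
  => [ O oO|a u v hu hv|v C u hv vC vu].
- have [q cq hq] := open_gt0_C_infty oO.
  have q0 x : 0 <= q x by have [/andP[]] := hq x.
  apply: (@markov_functional_lim _ _ _ _ _ _ hX
    (fun n p => ext0 (fun x => Num.min 1 (n%:R * q x)) (announced_place p)) _
      1) => [n|n p _|p _].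
  + by apply: markov_functional_announced_C_infty; exact: C_infty_minZ.
  + case: (announced_place p) => [x|] /=; rewrite ?normr0//.
    by rewrite ger0_norm ?ge_min ?lexx// le_min ler01 mulr_ge0.
  + case: (announced_place p) => [x|] /=; last exact: cvg_cst.
    have [Ox|nOx] := pselect (O x); rewrite indicE.
      rewrite mem_set//; have qx : 0 < q x by have [_ []] := hq x; auto.
      apply/cvgrPdist_lt => e e0; near=> n.
      rewrite (_ : Num.min _ _ = 1) ?subrr ?normr0//; apply/min_idPl.
      rewrite -ler_pdivrMr//; near: n; exact: nbhs_infty_ger.
    rewrite memNset//; have -> : q x = 0.
      apply/eqP; rewrite eq_le q0 andbT leNgt; apply/negP => qx.
      by have [_ [/(_ qx)]] := hq x.
    rewrite (_ : (fun n => _) = (fun=> 0)); first exact: cvg_cst.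
    by apply/funext => n; rewrite mulr0; apply/min_idPr.
- rewrite [X in markov_functional _ _ X](_ : _ =
    fun p => a * ext0 u (announced_place p) + ext0 v (announced_place p)).
    exact: markov_functional_lin.
  by apply/funext => p; case: (announced_place p) => //=; rewrite mulr0 addr0.
- apply: (@markov_functional_lim _ _ _ _ _ _ hX (fun n p =>
    ext0 (v n) (announced_place p)) _ `|C|) => //.
    by move=> n p _; exact: ext0_bound.
  by move=> p _; case: (announced_place p) => [x|] /=;
    [exact: vu|exact: cvg_cst].
Unshelve. all: by end_near. Qed.

(* Quasi-left-continuity: at the hitting time of {g < c} the value of g(X) is at
   most c, hence its mean a short time later is nearly so, uniformly, by strong
   continuity; such slightly delayed hitting times converge to the announced
   time from the right, where X is right-continuous. *)
Lemma path_mean_announced x : (forall y, 0 <= g y) ->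
  path_mean P X (fun p => ext0 g (announced_place p)) x = 0.
Proof.
move=> g0; have [C gC] := C_infty_bounded cg.
have [MF0 [b0 c0] [b1 c1] b2 c2] := stage_limits cg gC.
have MF1 m n : markov_functional P X (fun p => delayed g m n p).
  exact: (markov_functional_lim hX (MF0 m n) (b0 m n) (c0 m n)).
have MF2 m : markov_functional P X (fun p => limn (fun n => delayed g m n p)).
  exact: (markov_functional_lim hX (MF1 m) (b1 m) (c1 m)).
have l0 m n := @path_mean_lim _ _ _ _ _ _ hX _ _ _ (MF0 m n) (b0 m n) (c0 m n)
  x.
have l1 m := @path_mean_lim _ _ _ _ _ _ hX _ _ _ (MF1 m) (b1 m) (c1 m) x.
have l2 := @path_mean_lim _ _ _ _ _ _ hX _ _ _ MF2 b2 c2 x.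
have ge0 : 0 <= path_mean P X (fun p => ext0 g (announced_place p)) x.
  by apply: path_mean_ge0 => p; case: (announced_place p) => //=.
apply/eqP; rewrite eq_le ge0 andbT; apply/ler_addgt0Pr => e e0; rewrite add0r.
rewrite -(cvg_lim (@Rhausdorff R) l2); apply: limr_le; first by apply/cvg_ex;
  eexists; exact: l2.
have e2 : 0 < e / 2 by rewrite divr_gt0.
have [t0 t00 ht] := semigroup_cvg0 hX cg e2.
near=> m.
rewrite -(cvg_lim (@Rhausdorff R) (l1 m)); apply: limr_le.
  by apply/cvg_ex; eexists; exact: (l1 m).
near=> n.
rewrite -(cvg_lim (@Rhausdorff R) (l0 m n)); apply: limr_le.
  by apply/cvg_ex; eexists; exact: (l0 m n).
apply: nearW => k.
have ne : n.+1%:R^-1 <= e / 2.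
  by near: n; have := @near_infty_natSinv_lt R (PosNum e2);
    apply: filterS => n /ltW.
have mt : m.+1%:R^-1 < t0 by near: m; exact: (@near_infty_natSinv_lt R (PosNum
  t00)).
rewrite [leRHS](splitr e); apply: (@le_trans _ _ (n.+1%:R^-1 + e / 2)).
  apply: (path_mean_first_hit_le hX) => // [|y]; first exact: ltW.
  by apply: ht; rewrite invr_ge0 ler0n.
by rewrite lerD2r.
Unshelve. all: by end_near. Qed.

End announced_value.

(** * The exit time *)

Section exit_time.
Variable R : realType.
Implicit Types (c t : R) (F G : R -> R).

Lemma hit_time_shift c G t : 0 <= t ->
  (forall r, 0 <= r -> r < t -> c <= G r) ->
  hit_time c G = (t%:E + hit_time c (fun r => G (t + r)%R))%E.
Proof.
move=> t0 Gc; apply/eqP; rewrite eq_le; apply/andP; split.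
  rewrite -leeBlDl//; apply: le_ereal_inf_tmp => _ [r [r0 Gr] <-].
  by rewrite leeBlDl// -EFinD; apply: hit_time_le => //; exact: addr_ge0.
apply: le_ereal_inf_tmp => _ [r [r0 Gr] <-].
have tr : t <= r by rewrite leNgt; apply/negP => /(Gc _ r0); rewrite leNgt Gr.
rewrite -[r](subrKC t) EFinD leeD2l//; apply: hit_time_le;
  first by rewrite subr_ge0.
by rewrite subrKC.
Qed.

(** Only hitting times of levels at most c are known to shift. They increase as the level decreases,
    so replacing n by max(m, n), with 1/(m+1) < c, leaves the supremum unchanged. *)
Lemma announced_time_shift c G t : 0 < c -> 0 <= t ->
  (forall r, 0 <= r -> r < t -> c <= G r) ->
  announced_time G = (t%:E + announced_time (fun r => G (t + r)%R))%E.
Proof.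
move=> c0 t0 Gc.
have [m mc] : exists m : nat, m.+1%:R^-1 < c.
  have [m _ hm] := @near_infty_natSinv_lt R (PosNum c0).
  by exists m; apply: hm => /=.
have maxE n : hit_time (maxn m n).+1%:R^-1 G =
    (t%:E + hit_time (maxn m n).+1%:R^-1 (fun r => G (t + r)%R))%E.
  apply: hit_time_shift => // r r0 rt; apply: le_trans (Gc r r0 rt).
  by apply/ltW/(le_lt_trans _ mc); rewrite lef_pV2 ?posrE// ler_nat ltnS
    leq_maxl.
have le_max n F : (hit_time n.+1%:R^-1 F <= hit_time (maxn m n).+1%:R^-1 F)%E.
  by apply: le_hit_time; rewrite lef_pV2 ?posrE// ler_nat ltnS leq_maxr.
apply/eqP; rewrite eq_le; apply/andP; split.
  apply: ge_ereal_sup => _ [n _ <-]; rewrite (le_trans (le_max n G))// maxE.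
  by rewrite leeD2l// hit_time_announced.
rewrite addeC -leeBrDr//; apply: ge_ereal_sup => _ [n _ <-].
by rewrite leeBrDr// addeC (le_trans _ (hit_time_announced (maxn m n) G))//
  maxE leeD2l.
Qed.

Lemma announced_place_shift (d : nat) (g : 'rV[R]_d -> R) (p : R ->
  rV_cemetery R d)
    c t : 0 < c -> 0 <= t ->
  (forall r, 0 <= r -> r < t -> c <= ext0 g (p r)) ->
  announced_place g p = announced_place g (fun r => p (t + r)).
Proof.
move=> c0 t0 gc; rewrite /announced_place (announced_time_shift c0 t0 gc).
have := announced_time_ge0 (fun r => (ext0 g \o p) (t + r)).
rewrite -[(fun r => _ (t + r))]/(ext0 g \o (fun r => p (t + r))).
by case: announced_time.
Qed.

(** As g vanishes off U and at the cemetery, the announced time never exceeds the exit time. If it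
    is finite, g = 0 there means that the path is already outside U; if it is infinite, both are. *)
Lemma at_exit_time (d : nat) (Omega : Type) (X : R -> Omega -> rV_cemetery R d)
    (U : set 'rV[R]_d) (g : 'rV[R]_d -> R) w :
  (forall x, 0 <= g x) -> (forall x, 0 < g x <-> U x) ->
  ext0 g (announced_place g (X ^~ w)) = 0 ->
  at_time X (exit_time X U) w = announced_place g (X ^~ w).
Proof.
move=> g0 gU.
have outU z : ~ (Some @` U) z <-> ext0 g z = 0.
  split=> [nUz|].
    case: z nUz => [x|]//= nUx; apply/eqP; rewrite eq_le g0 andbT leNgt.
    by apply/negP => /gU Ux; apply: nUx; exists x.
  by move=> + [x Ux xz]; rewrite -xz /=; move/gU: Ux => /[swap] ->;
    rewrite ltxx.
have le_exit : (announced_time (ext0 g \o (X ^~ w)) <= exit_time X U w)%E.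
  apply: ge_ereal_sup => _ [n _ <-]; apply: le_ereal_inf_tmp =>
    _ [t [t0 tU] <-].
  by apply: hit_time_le => //=; rewrite (outU _).1.
rewrite /announced_place /at_time; move: le_exit (announced_time_ge0 (ext0 g \o
  (X ^~ w))).
case E : announced_time => [t| |] //.
  rewrite lee_fin => te t0 gt.
  suff -> : exit_time X U w = t%:E by [].
  apply/eqP; rewrite eq_le te andbT; apply: ereal_inf_lbound.
  by exists t => //; split => //; exact/outU.
by rewrite leye_eq => /eqP ->.
Qed.

End exit_time.

(** * Exit expectations and their approximation by the semigroup *)

Section feller_exit.
Context (R : realType) (d : nat) (dO : measure_display)
  (Omega : measurableType dO) (P : 'rV[R]_d -> probability Omega R)
  (X : R -> Omega -> rV_cemetery R d).
Hypothesis hX : feller_process P X.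
Local Notation path := (R -> rV_cemetery R d).
Local Notation T := (semigroup P X).
Implicit Types (p : path) (s t : R) (u v f g : 'rV[R]_d -> R).

(** The nonnegative function g has mean 0 at the announced place, so it vanishes there off a null
    set, and off that set the two places coincide. *)
Lemma exit_expectation_announced (U : set 'rV[R]_d) g u x : C_infty g ->
  (forall x, 0 <= g x) -> (forall x, 0 < g x <-> U x) -> bounded_borel u ->
  exit_expectation P X U u x =
  path_mean P X (fun p => ext0 u (announced_place g p)) x.
Proof.
move=> cg g0 gU bu.
have bg := C_infty_bounded_borel cg.
have MFg := markov_functional_announced hX cg bg.
have mg := markov_functional_path MFg.
have [[C gC] _ _ _] := MFg.
set phi := fun w => ext0 g (announced_place g (X ^~ w)) in mg.
have phi0 w : 0 <= phi w by rewrite /phi; case: (announced_place _ _) => //=.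
have mE : measurable_fun setT (EFin \o phi) by exact/measurable_EFinP.
have I0 : (\int[P x]_w `|(EFin \o phi) w| = 0)%E.
  under eq_integral => w _ do rewrite gee0_abs ?lee_fin//.
  have := path_mean_announced hX cg x g0; rewrite /path_mean /Rintegral.
  move=> H; rewrite -[LHS]fineK; first by rewrite H.
  apply: integrable_fin_num => //.
  apply: (@bounded_integrable _ _ _ _ _ _ C) => // w.
  by apply: gC; exact: (cadlag_path hX).
have /(ae_eq_integral_abs _ measurableT mE)[N [mN PN subN]] := I0.
apply: (Rintegral_eq_off_null mN PN) => w nNw; congr ext0.
apply: at_exit_time => //; apply: contrapT => phiw; apply: nNw;
  apply: subN => /= H.
by apply: phiw; have [] := H I.
Qed.

(** N indicates that g(X) >= c on [0, t[ and that X is alive at t. Let q be its mean at a point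
    where g = M. Then M - eps <= T_t g <= (M - c - eps) q + c + eps, hence (M - c)(1 - q) <= 2 eps -
    eps q. *)
Lemma path_mean_stay g (M c t eps : R) : C_infty g -> (forall y, g y <= M) ->
  0 <= c -> 0 <= eps -> c + eps <= M -> 0 < t ->
  (forall s y, 0 <= s <= t -> `|T s g y - g y| <= eps) ->
  exists2 N : path -> R, markov_functional P X N &
    (forall p, N p = 0 \/
      (N p = 1 /\ forall r, 0 <= r -> r < t -> c <= ext0 g (p r))) /\
    forall x, g x = M -> (M - c) * (1 - path_mean P X N x) <= 2 * eps.
Proof.
move=> cg gM c0 eps0 ceM t0 hT; have bg := C_infty_bounded_borel cg.
have b0 := bounded_borel_cst d (0 : R); have b1 := bounded_borel_cst d (1 : R).
(* With this mesh the k + 1 tested points lie in [0, t[ and the search ends exactly at t. *)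
pose mesh (k : nat) := t / k.+1%:R.
have mesh0 k : 0 < mesh k by rewrite /mesh divr_gt0.
pose N_ (k : nat) : path -> R :=
  first_hit (ext0 g) (ext0 (fun=> 0)) (ext0 (fun=> 1)) c (mesh k) 0 k.+1.
pose N p := if `[< forall r, 0 <= r -> r < t -> c <= ext0 g (p r) >]
  then ext0 (fun=> 1 : R) (p t) else 0.
have e01 (z : rV_cemetery R d) : ext0 (fun=> 1 : R) z = 0 \/ ext0 (fun=> 1 : R)
  z = 1.
  by case: z => [x|]; [right|left].
have ef0 (z : rV_cemetery R d) : ext0 (fun=> 0 : R) z = 0 by case: z.
have N01 k p : 0 <= N_ k p <= 1.
  rewrite /N_; case: (first_hitP (ext0 g) (ext0 (fun=> 0)) (ext0 (fun=> 1)) c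
    (mesh k) 0 k.+1 p)
    => [[-> _]|[i [_ _ _ ->]]].
    by case: (e01 (p (k.+1%:R * mesh k))) => ->; rewrite ?lexx ?ler01.
  by rewrite ef0 lexx ler01.
have MFN k : markov_functional P X (N_ k).
  by have [] := markov_functional_first_hit hX c k.+1 bg b0 b1 (ltW (mesh0 k))
    (lexx 0).
have bN k p : cadlag p -> `|N_ k p| <= 1.
  by move=> _; have /andP[N0 N1] := N01 k p; rewrite ger0_norm.
have cN p : cadlag p -> N_ ^~ p @ \oo --> N p.
  move=> cp; have rG := cadlag_right_continuous cg cp.
  rewrite /N; case: ifPn => /asboolP stay.
    rewrite (_ : (fun k => _) = (fun=> ext0 (fun=> 1) (p t)));
      first exact: cvg_cst.
    apply/funext => k; rewrite /N_.
    case: (first_hitP (ext0 g) (ext0 (fun=> 0)) (ext0 (fun=> 1)) c (mesh k) 0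
      k.+1 p)
      => [[-> _]|[i [ik gi _ _]]]; first by rewrite /mesh mulrCA divff ?mulr1.
    exfalso; move: gi; rewrite ltNge => /negP; apply; apply: stay.
      by rewrite mulr_ge0 // ltW.
    by rewrite /mesh mulrCA gtr_pMr// ltr_pdivrMr// mul1r ltr_nat.
  have [r [r0 rt gr]] : exists r, [/\ 0 <= r, r < t & ext0 g (p r) < c].
    apply: contrapT => H; apply: stay => r r0 rt; rewrite leNgt;
      apply/negP => gr.
    by apply: H; exists r.
  have [h h0 hh] := grid_hit rG r0 rt gr.
  apply/cvgrPdist_lt => e e0; near=> k.
  have [|i [ri it gi]] := hh (mesh k).
    rewrite mesh0 /= /mesh -ltr_pdivlMl// mulrC; near: k.
    exact: (@near_infty_natSinv_lt R (PosNum (divr_gt0 h0 t0))).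
  rewrite /N_; case: (first_hitP (ext0 g) (ext0 (fun=> 0)) (ext0 (fun=> 1)) c
    (mesh k) 0 k.+1 p)
    => [[_ /(_ i)]|[i' [_ _ _ ->]]]; last by rewrite ef0 subrr normr0.
  have ik : (i < k.+1)%N.
    by move: it; rewrite /mesh mulrCA gtr_pMr// ltr_pdivrMr// mul1r ltr_nat.
  by move=> /(_ ik); rewrite leNgt [_ < _]gi.
exists N; first exact: (markov_functional_lim hX MFN bN cN).
split => [p|x gx].
  rewrite /N; case: ifPn => /asboolP stay; last by left.
  by case: (e01 (p t)) => ->; [left|right].
have lN := @path_mean_lim _ _ _ _ _ _ hX _ _ _ MFN bN cN x.
have lN' : (M - c) * (1 - path_mean P X (N_ k) x) @[k --> \oo] -->
    (M - c) * (1 - path_mean P X N x).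
  by apply: cvgMl_tmp; apply: cvgB => //; exact: cvg_cst.
rewrite -(cvg_lim (@Rhausdorff R) lN'); apply: limr_le.
  by apply/cvg_ex; eexists; exact: lN'.
apply: nearW => k.
have kt : k.+1%:R * mesh k = t by rewrite /mesh mulrCA divff ?mulr1.
have N0 : 0 <= path_mean P X (N_ k) x.
  by apply: path_mean_ge0 => p; have /andP[] := N01 k p.
have := @semigroup_le_first_hit _ _ _ _ _ _ hX g M c (mesh k) t eps k.+1 x cg
  gM c0 eps0 ceM
  (ltW (mesh0 k)); rewrite kt -[semigroup P X]/T => /(_ (lexx t) hT).
have tt : 0 <= t <= t by rewrite lexx ltW.
have := hT t x tt; rewrite ler_norml gx -/(N_ k) => /andP[h1 h2] h3.
have := mulr_ge0 eps0 N0; move: N0 h3 h1 h2; set q := path_mean _ _ _ _;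
  set y := T t g x.
move=> q0 h3 h1 h2 eq0; rewrite mulrBr mulr1.
rewrite mulrBl in h3; lra.
Unshelve. all: by end_near. Qed.

(** The semigroup term is the mean of Phi on the path shifted by t. Where N = 1 the two values of
    Phi agree; elsewhere they differ by at most 2 C. *)
Lemma path_mean_semigroup (Phi N : path -> R) (C t : R) x :
  markov_functional P X Phi -> markov_functional P X N -> 0 <= t ->
  (forall p, `|Phi p| <= C) ->
  (forall p, N p = 0 \/ (N p = 1 /\ Phi p = Phi (fun r => p (t + r)))) ->
  `|path_mean P X Phi x - T t (path_mean P X Phi) x| <=
    2 * C * (1 - path_mean P X N x).
Proof.
move=> MFP MFN t0 PC PN.
have [_ mP _ kP] := MFP; have mP0 := markov_functional_path MFP.
have mN0 := markov_functional_path MFN; have mPt := mP t t0.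
have N1 p : `|N p| <= 1 by case: (PN p) => [->|[-> _]]; rewrite ?normr0 ?normr1.
have i1 := bounded_integrable (P x) measurableT mP0 (fun w => PC _).
have i2 := bounded_integrable (P x) measurableT mPt (fun w => PC _).
have iN := bounded_integrable (P x) measurableT mN0 (fun w => N1 _).
have i12 : (P x).-integrable setT
    (EFin \o (fun w => Phi (X ^~ w) - Phi (fun r => X (t + r) w))).
  apply: (@bounded_integrable _ _ _ _ _ _ (C + C)) => //.
    exact: measurable_funB.
  by move=> w; rewrite (le_trans (ler_normB _ _))// lerD.
have iN' : (P x).-integrable setT (EFin \o (fun w => 1 - N (X ^~ w))).
  apply: (@bounded_integrable _ _ _ _ _ _ (1 + 1)) => //.
    exact: measurable_funB.
  by move=> w; rewrite (le_trans (ler_normB _ _))// lerD ?normr1.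
have -> : T t (path_mean P X Phi) x = \int[P x]_w Phi (fun r => X (t + r) w).
  by rewrite kP//; exact: natural_filtrationT.
rewrite /path_mean -RintegralB//; apply: (le_trans (le_normr_Rintegral
  measurableT i12)).
rewrite -[X in X - _](Rintegral_prob_cst (P x)) -RintegralB//; last first.
  exact: finite_measure_integrable_cst.
rewrite -RintegralZl//; apply: le_Rintegral => //.
- apply: (@bounded_integrable _ _ _ _ _ _ (C + C)) => //.
    by apply: measurableT_comp => //; exact: measurable_funB.
  by move=> w; rewrite normr_id (le_trans (ler_normB _ _))// lerD.
- by have := integrableZl measurableT (2 * C) iN';
    under eq_fun do rewrite -EFinM.
- move=> w _; case: (PN (X ^~ w)) => [->|[-> ->]].
    by rewrite subr0 mulr1 (le_trans (ler_normB _ _))// mulr_natl mulr2n lerD.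
  by rewrite !subrr normr0 mulr0.
Qed.

End feller_exit.

Unset Implicit Arguments.

Theorem theorem3p4 (R : realType) (d : nat) (dO : measure_display)
    (Omega : measurableType dO) (P : 'rV[R]_d -> probability Omega R)
    (X : R -> Omega -> rV_cemetery R d)
    (hX : feller_process P X)
    (hA : @Cc_infty R d `<=` generator_domain (semigroup P X))
    (hS : strong_feller (semigroup P X))
    (U : set 'rV[R]_d) (hU : open U)
    (u : 'rV[R]_d -> R) (hu : bounded_borel u) :
  {within U, continuous (exit_expectation P X U u)}.
Proof.
have [g cg hg] := open_gt0_C_infty hU.
have g0 x : 0 <= g x by have [/andP[]] := hg x.
have gU x : 0 < g x <-> U x by have [_] := hg x.
have MFP := markov_functional_announced hX cg hu.
set Phi := fun p => ext0 u (announced_place g p) in MFP.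
have -> : exit_expectation P X U u = path_mean P X Phi.
  by apply/funext => x; exact: (exit_expectation_announced hX x cg g0 gU hu).
have /bounded_borelP[[C uC] _] := hu.
pose C' := `|C| + 1; have C'0 : 0 < C' by rewrite /C' ltr_wpDl.
have PhiC p : `|Phi p| <= C'.
  by rewrite (le_trans (ext0_bound uC _))// /C' lerDl.
apply/subspace_continuousP => x0 /gU gx0.
apply: cvg_within_filter; apply/(@cvgrPdist_le _ _ _ (nbhs x0)) => e e0.
(* M < g(x0) makes {g > M} a neighbourhood of x0, and M - c = c leaves room below M. *)
pose c := g x0 / 4; pose M := g x0 / 2.
have c0 : 0 < c by rewrite /c divr_gt0.
have Mc : M - c = c by rewrite /M /c; lra.
have M0 : 0 <= M by rewrite /M divr_ge0.
(* The first bound gives c + eps <= M; the second turns the error 2 C' (2 eps / c) into at most e /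
   3. *)
pose eps := Num.min c (e * c / (12 * C')).
have eps0 : 0 < eps by rewrite lt_min c0 divr_gt0 ?mulr_gt0.
have epsc : eps <= c by rewrite /eps ge_min lexx.
have cg' := C_infty_minZ M0 ler01 g0 cg.
have [t0 t00 ht] := semigroup_cvg0 hX cg' eps0.
have t20 : 0 < t0 / 2 by rewrite divr_gt0.
have g'M y : Num.min M (1 * g y) <= M by rewrite ge_min lexx.
have ceM : c + eps <= M by rewrite addrC -lerBrDr Mc.
have ht2 s y : 0 <= s <= t0 / 2 -> `|semigroup P X s (fun x =>
  Num.min M (1 * g x)) y -
    Num.min M (1 * g y)| <= eps.
  by move=> /andP[s0 st]; apply: ht; rewrite s0 (le_lt_trans st)//
    ltr_pdivrMr// mulr_natr mulr2n ltrDl.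
have [N MFN [hN NM]] := path_mean_stay hX cg' g'M (ltW c0) (ltW eps0) ceM t20
  ht2.
(* Staying above c for min(M, g) implies the same for g, so the announced place is unchanged by the
   shift. *)
have PN p : N p = 0 \/ (N p = 1 /\ Phi p = Phi (fun r => p (t0 / 2 + r))).
  case: (hN p) => [|[Np gp]]; [by left|right; split => //; congr ext0].
  apply: (announced_place_shift c0 (ltW t20)) => r r0 rt.
  rewrite (le_trans (gp r r0 rt))//; case: (p r) => [y|] //=.
  by rewrite mul1r ge_min lexx orbT.
have near_T x : M < g x ->
    `|path_mean P X Phi x - semigroup P X (t0 / 2) (path_mean P X Phi) x| <=
      e / 3.
  move=> gx; apply: (le_trans (path_mean_semigroup x MFP MFN (ltW t20) PhiC
    PN)).
  have := NM x; rewrite mul1r (min_idPl (ltW gx)) => /(_ erefl);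
    rewrite Mc => h1.
  have h2 : 12 * C' * eps <= e * c.
    by rewrite mulrC -ler_pdivlMr ?mulr_gt0// /eps ge_min lexx orbT.
  move: h1; set q := 1 - _ => h1; rewrite -(ler_pM2r c0).
  have C2 : 0 <= 2 * C' by rewrite mulr_ge0// ltW.
  have := ler_wpM2l C2 h1; rewrite mulrA [_ * c]mulrAC; lra.
(* Three errors of e / 3: the approximation at x, the one at x0, and the continuity of T_t h from
   the strong Feller property. *)
have [_ _ bPhi _] := MFP.
have [_ cT] := hS _ _ t20 bPhi.
have e3 : 0 < e / 3 by rewrite divr_gt0.
have Mg0 : M < g x0 by rewrite /M; lra.
have nearg : \forall x \near x0, M < g x.
  by have [cgg _] := cg; apply: (cvgr_gt (g x0) (cgg x0)).
have := cT x0 => /(@cvgrPdist_le _ _ _ _ (nbhs_filter x0))/(_ _ e3).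
apply: filterS2 nearg => x gx hx.
have := near_T x gx; have := near_T x0 Mg0; move: hx.
rewrite !ler_norml => /andP[a1 a2] /andP[b1 b2] /andP[d1 d2].
by rewrite /from_subspace; apply/andP; split; lra.
Qed.
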